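(* Let a power series $f\in\mathbb{Q}[[z]]$ be given by a linear differential operator $L\in\mathbb{Q}[z]\langle\partial_z\rangle$ such that $L(f(z))=0$, together with sufficiently many initial conditions, i.e. a truncated power series $f_0$ such that $f$ is the unique solution of $L(f)=0$ in $\mathbb{Q}[[z]]$ with truncation $f_0$. Then the procedure $\mathsf{TransTest}(L,f_0)$ described in the context either proves that $f$ is transcendental or returns $\mathsf{FAIL}$; that is, its output is either $\mathsf{T}$ or $\mathsf{FAIL}$, and whenever the output is $\mathsf{T}$, the power series $f$ is transcendental.
   Context: A power series $f\in\mathbb{Q}[[z]]$ is algebraic if $P(z,f(z))=0$ for some $P\in\mathbb{Q}[x,y]\setminus\{0\}$; otherwise it is transcendental. $\mathbb{Q}[z]\langle\partial_z\rangle$ and $\mathbb{Q}(z)\langle\partial_z\rangle$ are the rings of linear differential operators in $\partial_z=\frac{d}{dz}$ with coefficients in $\mathbb{Q}[z]$ and $\mathbb{Q}(z)$. $L^{\min}_f$ denotes the monic operator of minimal order in $\mathbb{Q}(z)\langle\partial_z\rangle$ that annihilates $f$; it can be computed from $(L,f_0)$ by a known algorithm (Bostan–Rivoal–Salvy). The finite singularities of an operator $a_r\partial_z^r+\cdots+a_0$ ($a_r\ne0$) are the points of $\overline{\mathbb{Q}}$ where some $a_i/a_r$ has a pole; infinity is a singularity when $0$ is a singularity of the equation obtained by the change of variables $z\mapsto 1/z$. The indicial polynomial at a point $s$ is the usual one (its roots are the local exponents at $s$); it has degree equal to the order of the operator exactly when $s$ is an ordinary or regular singular point. A formal solution at $s$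 is a local solution in generalized series in the local parameter $t$ ($t=z-s$, or $t=1/z$ at infinity), possibly involving powers of $\log t$. Procedure $\mathsf{TransTest}(L,f_0)$: 1. Compute $M:=L^{\min}_f$. 2. For each singularity $s$ of $M$: (a) let $P$ be the indicial polynomial of $M$ at $z=s$; if $\deg P<\operatorname{ord}(M)$, return $\mathsf{T}$; (b) let $Z$ be the set of distinct rational zeros of $P$; if $\operatorname{card} Z<\deg P$, return $\mathsf{T}$; (c) let $D=\{|z_i-z_j| : z_i,z_j\in Z\}\cap\mathbb{N}_{>0}$; if $D\neq\emptyset$, compute a basis $B$ of formal solutions of $M$ at $z=s$ truncated at order $\max(D)$, and if $B$ contains logarithms, return $\mathsf{T}$. 3. Return $\mathsf{FAIL}$. *)

(* Defs.v *)
From mathcomp Require Import all_boot all_order all_algebra all_field.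

Set Implicit Arguments.
Unset Strict Implicit.
Unset Printing Implicit Defensive.

Import Order.TTheory GRing.Theory Num.Theory.
Local Open Scope ring_scope.

(* The field of algebraic numbers is [algC].  An operator
   \sum_i a_i d^i is encoded as the polynomial \sum_i a_i 'X^i in d, i.e. as
   the list of its left coefficients.  The (commutative) product of [{poly _}]
   is only used to multiply by a coefficient on the left or by d on the right,
   where it agrees with the composition of operators.
   The order of an operator A != 0 is (size A).-1. *)

Definition series (F : Type) := nat -> F.

Section Series.
Variable F : nzRingType.
Implicit Types (f g : series F) (p : {poly F}).

Definition ser_one : series F := fun n => (n == 0)%:R.

Definition ser_mul f g : series F :=
  fun n => \sum_(i < n.+1) f i * g (n - i)%N.

Definition ser_exp f (j : nat) : series F := iter j (ser_mul f) ser_one.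

Definition ser_deriv f : series F := fun n => f n.+1 *+ n.+1.

Definition ser_of_poly p : series F := fun n => p`_n.

Definition op_series (A : {poly {poly F}}) f : series F := fun n =>
  \sum_(i < size A) ser_mul (ser_of_poly A`_i) (iter i ser_deriv f) n.

(* P(z, f(z)), the outer variable of P being the second one. *)
Definition eval_series (P : {poly {poly F}}) f : series F := fun n =>
  \sum_(j < size P) ser_mul (ser_of_poly P`_j) (ser_exp f j) n.

Definition algebraic_series f : Prop :=
  exists2 P : {poly {poly F}}, P != 0 & forall n, eval_series P f n = 0.

Definition transcendental f : Prop := ~ algebraic_series f.

Definition solution_from (L : {poly {poly F}}) (f0 : seq F) f : Prop :=
  (forall n, op_series L f n = 0) /\ mkseq f (size f0) = f0.

End Series.

Notation ratfun F := {fraction {poly F}}.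
Local Notation "x %:F" := (@FracField.tofrac _ x).

(* The product of M by a common denominator of its coefficients; see
   [clear_opE].  This left multiplication by a nonzero polynomial changes
   neither the solutions of M, nor its singularities, nor, up to a nonzero
   constant, its indicial polynomials. *)
Definition clear_op (F : fieldType) (M : {poly ratfun F}) : {poly {poly F}} :=
  \poly_(i < size M) (\n_(repr M`_i) *
    \prod_(j < size M | (j : nat) != i) \d_(repr M`_j)).

Definition denom_op (F : fieldType) (M : {poly ratfun F}) : {poly F} :=
  \prod_(j < size M) \d_(repr M`_j).

Lemma denom_op_neq0 (F : fieldType) (M : {poly ratfun F}) : denom_op M != 0.
Proof. by apply/prodf_neq0 => j _; exact: denom_ratioP. Qed.

Lemma frac_numden (R : idomainType) (x : {fraction R}) :
  (\d_(repr x))%:F * x = (\n_(repr x))%:F.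
Proof.
rewrite -{2}[x]reprK; unlock FracField.tofrac; rewrite -[LHS]FracField.pi_mul.
rewrite /FracField.mulf !numden_Ratio ?oner_neq0 // mul1r.
apply/eqmodP; rewrite /= FracField.equivfE.
by rewrite !numden_Ratio ?mulf_neq0 ?oner_neq0 ?denom_ratioP // mulr1.
Qed.

Lemma clear_opE (F : fieldType) (M : {poly ratfun F}) i :
  ((clear_op M)`_i)%:F = (denom_op M)%:F * M`_i.
Proof.
rewrite coef_poly; case: ltnP => [lt_iM | le_Mi]; last first.
  by rewrite tofrac0 nth_default ?mulr0.
rewrite /denom_op [in RHS](bigD1 (Ordinal lt_iM)) //=.
by rewrite !tofracM mulrAC frac_numden.
Qed.

Definition annihilates (F : fieldType) (M : {poly ratfun F}) (f : series F) :=
  forall n, op_series (clear_op M) f n = 0.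

Definition is_min_op (F : fieldType) (M : {poly ratfun F}) (f : series F) :=
  [/\ M \is monic, annihilates M f &
      forall M' : {poly ratfun F},
        M' != 0 -> annihilates M' f -> (size M <= size M')%N].

(* t^N p(1/t) *)
Definition rev_poly (F : nzRingType) (N : nat) (p : {poly F}) : {poly F} :=
  \poly_(j < N.+1) p`_(N - j).

(* Since d/dz = - t^2 d/dt for t = 1/z, [inf_deriv i] is (d/dz)^i as an operator
   in t and d/dt; composing d/dt with \sum_k b_k (d/dt)^k gives
   \sum_k (b_k' (d/dt)^k + b_k (d/dt)^k.+1). *)
Definition inf_deriv (F : nzRingType) (i : nat) : {poly {poly F}} :=
  iter i (fun B => (- 'X^2)%:P * (map_poly (@deriv F) B + B * 'X)) 1.

(* t^N A(1/t, - t^2 d/dt), with N large enough to get polynomial coefficients *)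
Definition inf_op (F : nzRingType) (A : {poly {poly F}}) : {poly {poly F}} :=
  \sum_(i < size A)
    (rev_poly (\max_(j < size A) (size (A`_j)%R).-1) A`_i)%:P * inf_deriv F i.

(* [Some s] is the finite point s, [None] is the point at infinity. *)
Definition point := option algC.

(* M, up to left multiplication by a nonzero rational function, in terms of the
   local parameter t = z - s or t = 1/z. *)
Definition local_op (M : {poly ratfun rat}) (s : point) : {poly {poly algC}} :=
  let A := clear_op M in
  if s is Some s0
  then map_poly (fun a : {poly rat} => map_poly ratr a \Po ('X + s0%:P)) A
  else map_poly (map_poly ratr) (inf_op A).

Definition has_pole (F : fieldType) (r : ratfun F) (x : F) : Prop :=
  ~ exists p q : {poly F}, q.[x] != 0 /\ r = p%:F / q%:F.

Definition singularity (M : {poly ratfun rat}) (s : point) : Prop :=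
  let B := local_op M s in
  exists i : nat, has_pole ((B`_i)%:F / (lead_coef B)%:F) 0.

(* X (X - 1) ... (X - i + 1) *)
Definition ffact_poly (F : nzRingType) (i : nat) : {poly F} :=
  \prod_(j < i) ('X - (j%:R)%:P).

(* For B = \sum_i b_i(t) (d/dt)^i of order r,
     t^r B(t^x) = \sum_n (indicial_coef B n)(x) t^(x + n). *)
Definition indicial_coef (F : nzRingType) (B : {poly {poly F}}) (n : nat) :
    {poly F} :=
  \sum_(i < size B) ('X^((size B).-1 - i) * B`_i)`_n *: ffact_poly F i.

Definition is_indicial (M : {poly ratfun rat}) (s : point) (P : {poly algC}) :=
  exists n, [/\ P = indicial_coef (local_op M s) n, P != 0 &
    forall m, (m < n)%N -> indicial_coef (local_op M s) m = 0].

(* [c a k] is the coefficient of t^a (log t)^k. *)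
Definition logseries := algC -> nat -> algC.

(* Membership in t^rho algC[[t]][log t] for some rho.  Sums of such series for
   several rho are not considered by themselves, but as elements of the linear
   span of these. *)
Definition is_genseries (c : logseries) : Prop :=
  exists (rho : algC) (K : nat), forall a k, c a k != 0 ->
    (exists n : nat, a = rho + n%:R) /\ (k <= K)%N.

Definition ls_deriv (c : logseries) : logseries := fun a k =>
  (a + 1) * c (a + 1) k + k.+1%:R * c (a + 1) k.+1.

Definition ls_mulp (p : {poly algC}) (c : logseries) : logseries := fun a k =>
  \sum_(i < size p) p`_i * c (a - i%:R) k.

Definition ls_op (B : {poly {poly algC}}) (c : logseries) : logseries :=
  fun a k => \sum_(i < size B) ls_mulp B`_i (iter i ls_deriv c) a k.

Definition formal_solution (M : {poly ratfun rat}) (s : point) (c : logseries) :=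
  is_genseries c /\ forall a k, ls_op (local_op M s) c a k = 0.

Definition is_formal_basis (M : {poly ratfun rat}) (s : point) (d : nat)
    (B : 'I_d -> logseries) : Prop :=
  [/\ forall i, formal_solution M s (B i),
      forall u : 'I_d -> algC,
        (forall a k, \sum_i u i * B i a k = 0) -> forall i, u i = 0 &
      forall c, formal_solution M s c ->
        exists u : 'I_d -> algC, forall a k, c a k = \sum_i u i * B i a k].

Definition leading_exponent (c : logseries) (rho : algC) : Prop :=
  (exists k, c rho k != 0) /\
  (forall a k, c a k != 0 -> exists n : nat, a = rho + n%:R).

(* The order of truncation is relative to the leading exponent, and inclusive:
   the terms in t^rho, ..., t^(rho + N) are kept. *)
Definition is_truncation (N : nat) (c ct : logseries) : Prop :=
  exists2 rho, leading_exponent c rho &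
    forall a k,
      ct a k = if [exists n : 'I_N.+1, a == rho + n%:R] then c a k else 0.

Definition contains_log (c : logseries) : Prop :=
  exists a k, (0 < k)%N /\ c a k != 0.

Definition is_truncated_basis (M : {poly ratfun rat}) (s : point) (N d : nat)
    (Bt : 'I_d -> logseries) : Prop :=
  exists2 B : 'I_d -> logseries, is_formal_basis M s B &
    forall i, is_truncation N (B i) (Bt i).

Inductive answer := T | FAIL.

Definition rational_zeros (P : {poly algC}) (Z : seq rat) : Prop :=
  uniq Z /\ forall q, (q \in Z) = root P (ratr q).

Definition positive_gaps (Z : seq rat) : seq nat :=
  [seq Num.truncn x | x <- [seq `|x - y| | x <- Z, y <- Z]
                    & (x \is a Num.nat) && (0 < x)].

(* [inspect M s b]: a run of the body of the loop at the point s either returns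
   T (b = true) or proceeds to the next singularity (b = false). *)
Inductive inspect (M : {poly ratfun rat}) (s : point) : bool -> Prop :=
| inspect_irregular P :
    is_indicial M s P -> ((size P).-1 < (size M).-1)%N -> inspect M s true
| inspect_zeros P Z :
    is_indicial M s P -> ~~ ((size P).-1 < (size M).-1)%N ->
    rational_zeros P Z -> (size Z < (size P).-1)%N -> inspect M s true
| inspect_no_gap P Z :
    is_indicial M s P -> ~~ ((size P).-1 < (size M).-1)%N ->
    rational_zeros P Z -> ~~ (size Z < (size P).-1)%N ->
    positive_gaps Z = [::] -> inspect M s false
| inspect_log P Z d (Bt : 'I_d -> logseries) :
    is_indicial M s P -> ~~ ((size P).-1 < (size M).-1)%N ->
    rational_zeros P Z -> ~~ (size Z < (size P).-1)%N ->
    positive_gaps Z <> [::] ->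
    is_truncated_basis M s (\max_(n <- positive_gaps Z) n) Bt ->
    (exists i, contains_log (Bt i)) -> inspect M s true
| inspect_no_log P Z d (Bt : 'I_d -> logseries) :
    is_indicial M s P -> ~~ ((size P).-1 < (size M).-1)%N ->
    rational_zeros P Z -> ~~ (size Z < (size P).-1)%N ->
    positive_gaps Z <> [::] ->
    is_truncated_basis M s (\max_(n <- positive_gaps Z) n) Bt ->
    ~ (exists i, contains_log (Bt i)) -> inspect M s false.

Inductive inspect_all (M : {poly ratfun rat}) : seq point -> answer -> Prop :=
| inspect_all_nil : inspect_all M [::] FAIL
| inspect_all_stop s S : inspect M s true -> inspect_all M (s :: S) T
| inspect_all_next s S o :
    inspect M s false -> inspect_all M S o -> inspect_all M (s :: S) o.

(* [TransTest L f0 o]: some run of the procedure on (L, f0) returns o.  Runs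
   differ by the order in which the singularities are visited and by the bases
   that are computed. *)
Inductive TransTest (L : {poly {poly rat}}) (f0 : seq rat) (o : answer) : Prop :=
| TransTest_run f M S of
    solution_from L f0 f & is_min_op M f &
    uniq S & (forall s, s \in S <-> singularity M s) &
    inspect_all M S o.

(* Main.v *)
Require Import Defs.
From mathcomp Require Import all_boot all_order all_algebra all_field.
From mathcomp Require Import boolp ring zify.
From HB Require Import structures.

(** Why the answer [T] is a proof of transcendence: if f is algebraic, its
  minimal operator M of order r has, at every point s, r linearly independent
  solutions that are Puiseux series, and none of the three tests can succeed.

  Let Q be the minimal polynomial of f over Q(z), of degree n.  By Puiseux's
  theorem [puiseux_local], Q has n roots c_1, ..., c_n in Laurent series in a
  fractional power u = t^(1/(N+1)) of the local parameter t at s.  As Q is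
  separable, the derivative of a root of Q is a polynomial in this root, the
  same for f and for the c_j; hence each c_j solves every linear differential
  equation that f solves ([conjugate_solution]), in particular M.  As M is
  minimal, f, f', ..., f^(r-1) are linearly independent over Q(z); writing them
  in the basis 1, f, ..., f^(n-1) and multiplying by the invertible Vandermonde
  matrix of the c_j, one sees that the matrix of the c_j^(i), for i < r, has
  rank r ([conjugate_wronskian_rank]).  So the c_j span a space of dimension at
  least r over the constants.

  The link with the procedure is [formal_solution_eq0].  The lowest power t^a of
  a local solution is multiplied by the indicial polynomial P of M at s, with
  t d/dt in place of its variable, so a is a zero of P; if a is a simple zero,
  no logarithm multiplies t^a.  Consequently, a solution whose coefficients at
  the zeros of P vanish is zero, if it has no logarithm or if the zeros of P are
  simple.  Apply this to combinations of the c_j: their exponents are rational,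
  so r is at most the number of rational zeros of P; since P has degree at most
  r, it has degree r and r simple rational zeros.  Apply it again to the
  difference of any formal solution and the combination of the c_j with the same
  coefficients at the zeros of P: every formal solution is a combination of the
  c_j, and has no logarithm ([algebraic_local]).

  Puiseux's theorem itself is proved for monic polynomials over power series by
  induction on the degree: remove the subleading coefficient by a translation,
  scale by the least slope of the Newton polygon; the reduction modulo u is then
  not a power of a linear factor, and Hensel's lemma [hensel] lifts a coprime
  factorization.

  That the procedure always answers is mostly a matter of finiteness: there are
  finitely many singularities, and the basis of formal solutions, which is only
  computed when the zeros of P are simple and rational, exists because, by
  [formal_solution_eq0] again, a formal solution is determined by finitely many
  coefficients ([formal_basis_exists]). *)

Set Implicit Arguments.
Unset Strict Implicit.
Unset Printing Implicit Defensive.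

Import Order.TTheory GRing.Theory Num.Theory.
Local Open Scope ring_scope.
Local Notation "x %:F" := (@FracField.tofrac _ x).

(** * Formal power series *)

Definition fps (F : comNzRingType) := series F.

Section FpsRing.
Variable F : comNzRingType.
Implicit Types f g h : fps F.

HB.instance Definition _ := gen_eqMixin (fps F).
HB.instance Definition _ := gen_choiceMixin (fps F).

Definition fps_add f g : fps F := fun n => f n + g n.
Definition fps_opp f : fps F := fun n => - f n.
Definition fps_zero : fps F := fun=> 0.

Lemma fps_addA : associative fps_add.
Proof. by move=> f g h; apply/funext=> n; apply: addrA. Qed.
Lemma fps_addC : commutative fps_add.
Proof. by move=> f g; apply/funext=> n; apply: addrC. Qed.
Lemma fps_add0 : left_id fps_zero fps_add.
Proof. by move=> f; apply/funext=> n; apply: add0r. Qed.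
Lemma fps_addN : left_inverse fps_zero fps_opp fps_add.
Proof. by move=> f; apply/funext=> n; apply: addNr. Qed.

HB.instance Definition _ :=
  GRing.isZmodule.Build (fps F) fps_addA fps_addC fps_add0 fps_addN.

Definition trunc n f : {poly F} := \poly_(i < n.+1) f i.

(** Agreement up to order n reduces the identities of power series to those of
  polynomials: every operation below is continuous for it. *)
Definition agree n (p : {poly F}) f := forall i, (i <= n)%N -> p`_i = f i.

Lemma agree_trunc n f : agree n (trunc n f) f.
Proof. by move=> i le_in; rewrite coef_poly ltnS le_in. Qed.

Lemma agree_mul n p q f g :
  agree n p f -> agree n q g -> agree n (p * q) (ser_mul f g).
Proof.
move=> pf qg i le_in; rewrite coefM /ser_mul; apply: eq_bigr => j _.
by rewrite pf ?qg // (leq_trans _ le_in) ?leq_subr // -ltnS.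
Qed.

Lemma agree_eq f g :
  (forall n, exists p q, [/\ agree n p f, agree n q g & p = q]) -> f = g.
Proof.
by move=> fg; apply/funext=> n; have [p [q [<- // <- // ->]]] := fg n.
Qed.

Lemma fps_mulA : associative (@ser_mul F : fps F -> fps F -> fps F).
Proof.
move=> f g h; apply: agree_eq => n; have tr := @agree_trunc n.
exists (trunc n f * (trunc n g * trunc n h)); eexists; split.
- by do 2?apply: agree_mul.
- by do 2?apply: agree_mul.
- by rewrite mulrA.
Qed.

Lemma fps_mulC : commutative (@ser_mul F : fps F -> fps F -> fps F).
Proof.
move=> f g; apply: agree_eq => n; have tr := @agree_trunc n.
exists (trunc n f * trunc n g); eexists; split; try exact: agree_mul.
by rewrite mulrC.
Qed.

Lemma agree1 n : agree n 1 (@ser_one F).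
Proof. by move=> i _; rewrite coef1. Qed.

Lemma fps_mul1 : left_id (@ser_one F : fps F) (@ser_mul F).
Proof.
move=> f; apply: agree_eq => n; have tr := @agree_trunc n.
exists (1 * trunc n f); eexists; split.
- by apply: agree_mul => //; apply: agree1.
- exact: tr.
- by rewrite mul1r.
Qed.

Lemma fps_mulDl : left_distributive (@ser_mul F : fps F -> fps F -> fps F) +%R.
Proof.
move=> f g h; apply/funext=> n; rewrite /ser_mul -[RHS]big_split /=.
by apply: eq_bigr => i _; rewrite mulrDl.
Qed.

Lemma fps_one_neq0 : (@ser_one F : fps F) != 0.
Proof.
by apply/eqP => /(congr1 (@^~ 0%N)) /eqP; rewrite /ser_one eqxx oner_eq0.
Qed.

HB.instance Definition _ := GRing.Zmodule_isComNzRing.Build (fps F)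
  fps_mulA fps_mulC fps_mul1 fps_mulDl fps_one_neq0.

Lemma fpsM f g n : (f * g) n = \sum_(i < n.+1) f i * g (n - i)%N.
Proof. by []. Qed.
Lemma fpsD f g n : (f + g) n = f n + g n.
Proof. by []. Qed.
Lemma fpsN f n : (- f) n = - f n.
Proof. by []. Qed.
Lemma fps0E n : (0 : fps F) n = 0.
Proof. by []. Qed.
Lemma fps1E n : (1 : fps F) n = (n == 0%N)%:R.
Proof. by []. Qed.

Lemma fps_sumE (I : Type) (r : seq I) (P : pred I) (G : I -> fps F) n :
  (\sum_(i <- r | P i) G i) n = \sum_(i <- r | P i) G i n.
Proof. exact: (big_morph (fun f : fps F => f n) (fun f g => fpsD f g n)). Qed.

Lemma fpsXnE f j : f ^+ j = ser_exp f j.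
Proof. by elim: j => // j IHj; rewrite exprS IHj. Qed.

Lemma agreeD n p q f g : agree n p f -> agree n q g -> agree n (p + q) (f + g).
Proof. by move=> pf qg i le_in; rewrite coefD pf // qg. Qed.

Lemma agreeM n p q f g : agree n p f -> agree n q g -> agree n (p * q) (f * g).
Proof. exact: agree_mul. Qed.

Definition fps_of (p : {poly F}) : fps F := ser_of_poly p.

Lemma agree_of n p : agree n p (fps_of p). Proof. by []. Qed.

Lemma fps_of_zmod : zmod_morphism fps_of.
Proof. by move=> p q; apply/funext=> n; rewrite /fps_of /ser_of_poly coefB. Qed.
Lemma fps_of_monoid : monoid_morphism fps_of.
Proof.
split=> [|p q]; first by apply/funext=> n; rewrite /fps_of /ser_of_poly coef1.
by apply: agree_eq => n; exists (p * q); eexists; split; last 1 first;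
  do ?exact: agreeM.
Qed.
HB.instance Definition _ := GRing.isZmodMorphism.Build _ _ fps_of fps_of_zmod.
HB.instance Definition _ := GRing.isMonoidMorphism.Build _ _ fps_of fps_of_monoid.

Lemma fps_ofE p n : fps_of p n = p`_n. Proof. by []. Qed.

Lemma fps_of_inj : injective fps_of.
Proof. by move=> p q pq; apply/polyP => n; rewrite -!fps_ofE pq. Qed.

Lemma fps_ofX_mulE k f n :
  (fps_of 'X^k * f) n = if (n < k)%N then 0 else f (n - k)%N.
Proof.
rewrite -(agreeM (@agree_of n _) (@agree_trunc n f) (leqnn n)) coefXnM.
by case: ifP => // _; apply: agree_trunc; apply: leq_subr.
Qed.

Lemma fps_ofC_mulE a f n : (fps_of a%:P * f) n = a * f n.
Proof.
rewrite -(agreeM (@agree_of n _) (@agree_trunc n f) (leqnn n)) coefCM.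
by rewrite agree_trunc.
Qed.

Definition fps_deriv f : fps F := ser_deriv f.

Lemma agree_deriv n p f : agree n.+1 p f -> agree n p^`() (fps_deriv f).
Proof. by move=> pf i le_in; rewrite coef_deriv pf. Qed.

Lemma fps_derivD f g : fps_deriv (f + g) = fps_deriv f + fps_deriv g.
Proof. by apply/funext=> n; rewrite fpsD /fps_deriv /ser_deriv fpsD mulrnDl. Qed.

Lemma agreeW n p f : agree n.+1 p f -> agree n p f.
Proof. by move=> pf i le_in; apply/pf/ltnW. Qed.

Lemma fps_derivM f g :
  fps_deriv (f * g) = fps_deriv f * g + f * fps_deriv g.
Proof.
apply: agree_eq => n; have tr := @agree_trunc n.+1.
exists (trunc n.+1 f * trunc n.+1 g)^`().
exists ((trunc n.+1 f)^`() * trunc n.+1 g + trunc n.+1 f * (trunc n.+1 g)^`()).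
split.
- by apply/agree_deriv/agreeM.
- by apply: agreeD; apply: agreeM; do ?[exact: agreeW | exact: agree_deriv].
- by rewrite derivM.
Qed.

Lemma fps_deriv_of p : fps_deriv (fps_of p) = fps_of p^`().
Proof. by apply/funext=> n; rewrite fps_ofE coef_deriv. Qed.

(** The substitution of u^(N+1) for u; the shift excludes the exponent 0, for
  which the same formula is not injective. *)
Definition fps_subst (N : nat) f : fps F := 
  fun n => if (N.+1 %| n)%N then f (n %/ N.+1)%N else 0.

Lemma agree_subst N n p f : agree n p f -> agree n (p \Po 'X^(N.+1)) (fps_subst N f).
Proof.
move=> pf i le_in; rewrite coef_comp_poly_Xn // /fps_subst; case: ifP => // _.
by rewrite pf // (leq_trans (leq_div _ _)).
Qed.

Lemma fps_subst_zmod N : zmod_morphism (fps_subst N).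
Proof.
move=> f g; apply/funext=> n; rewrite fpsD fpsN /fps_subst.
by case: ifP => // _; rewrite subr0.
Qed.
Lemma fps_subst_monoid N : monoid_morphism (fps_subst N).
Proof.
split=> [|f g]; apply: agree_eq => n; have tr := @agree_trunc n.
  exists (1 \Po 'X^(N.+1)); exists 1; split; try exact: agree1.
    by apply: agree_subst; apply: agree1.
  by rewrite comp_polyC.
exists ((trunc n f * trunc n g) \Po 'X^(N.+1)); eexists; split.
- by apply/agree_subst/agreeM.
- by apply/agreeM; apply/agree_subst.
- by rewrite rmorphM.
Qed.
HB.instance Definition _ N :=
  GRing.isZmodMorphism.Build _ _ (fps_subst N) (fps_subst_zmod N).
HB.instance Definition _ N :=
  GRing.isMonoidMorphism.Build _ _ (fps_subst N) (fps_subst_monoid N).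

Lemma fps_subst_of N p : fps_subst N (fps_of p) = fps_of (p \Po 'X^(N.+1)).
Proof.
apply: agree_eq => n; exists (p \Po 'X^(N.+1)); exists (p \Po 'X^(N.+1)); split=> //.
by apply: agree_subst.
Qed.

Lemma fps_subst_comp N N' f :
  fps_subst N (fps_subst N' f) = fps_subst (N.+1 * N'.+1).-1 f.
Proof.
apply/funext=> n; rewrite /fps_subst prednK ?muln_gt0 //.
have [/dvdnP[m ->]|nN] := boolP (N.+1 %| n)%N; last first.
  case: ifP => // NN'; case/negP: nN.
  by apply: dvdn_trans NN'; rewrite dvdn_mulr.
by rewrite mulnK // [(m * _)%N]mulnC dvdn_pmul2l // divnMl.
Qed.

Lemma fps_subst_inj N : injective (fps_subst N).
Proof.
move=> f g /funeqP fg; apply/funext=> n.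
by have := fg (n * N.+1)%N; rewrite /fps_subst dvdn_mull // mulnK.
Qed.

Lemma fps_factor f : f != 0 ->
  exists m, exists2 g : fps F, g 0%N != 0 & f = fps_of 'X^m * g.
Proof.
move=> f0; have [n fn] : exists n, f n != 0.
  apply: contrapT => /forallNP fn; case/eqP: f0; apply/funext=> n.
  by apply/eqP; rewrite -[_ == _]negbK; apply/negP.
have exf : exists n, f n != 0 by exists n.
case: (ex_minnP exf) => m fm mmin; exists m, (fun i => f (m + i)%N).
  by rewrite addn0.
apply/funext=> i; rewrite fps_ofX_mulE; case: ltnP => [lt_im | /subnKC-> //].
by apply/eqP; apply: contraTT lt_im => /mmin; rewrite -leqNgt.
Qed.

End FpsRing.

Section FpsField.
Variable F : fieldType.
Implicit Types f g : fps F.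

Lemma fps_integral f g : f * g = 0 -> (f == 0) || (g == 0).
Proof.
move=> fg0; apply: contraT; rewrite negb_or => /andP[/fps_factor[m [f1 f10 ef]]].
case/fps_factor=> l [g1 g10 eg]; have := congr1 (@^~ (m + l)%N) fg0.
rewrite ef eg mulrACA -rmorphM /= -exprD fps_ofX_mulE ltnn subnn fpsM big_ord1.
by move/eqP; rewrite fps0E mulf_eq0 (negPf f10) (negPf g10).
Qed.

(** Integral domains come with a choice of inverses; [fps_unitE] below computes
  the actual ones. *)
Definition fps_unit : pred (fps F) := fun f => `[< exists g, g * f = 1 >].
Definition fps_inv f : fps F :=
  match pselect (exists g, g * f = 1) with left ex => sval (cid ex) | right _ => f end.
Lemma fps_mulV : {in fps_unit, left_inverse 1 fps_inv *%R}.
Proof.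
move=> f /asboolP fU; rewrite /fps_inv; case: pselect => // ex.
by case: cid.
Qed.
Lemma fps_unitP f g : g * f = 1 -> fps_unit f.
Proof. by move=> gf; apply/asboolP; exists g. Qed.
Lemma fps_inv_out : {in [predC fps_unit], fps_inv =1 id}.
Proof.
move=> f /negP fU; rewrite /fps_inv; case: pselect => // ex; case: fU.
exact/asboolP.
Qed.
HB.instance Definition _ := GRing.ComNzRing_hasMulInverse.Build (fps F)
  fps_mulV fps_unitP fps_inv_out.
HB.instance Definition _ := GRing.ComUnitRing_isIntegral.Build (fps F)
  fps_integral.

End FpsField.

(** * Derivations and morphisms on fields of fractions *)

Definition derivation (R : comNzRingType) (D : R -> R) :=
  (forall x y, D (x + y) = D x + D y) /\
  (forall x y, D (x * y) = D x * y + x * D y).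

Section Derivation.
Variables (R : comNzRingType) (D : R -> R).
Hypothesis derD : derivation D.

Lemma derD_add x y : D (x + y) = D x + D y. Proof. exact: derD.1. Qed.
Lemma derD_mul x y : D (x * y) = D x * y + x * D y. Proof. exact: derD.2. Qed.

Lemma der0 : D 0 = 0.
Proof. by apply: (@addrI _ (D 0)); rewrite -derD_add !addr0. Qed.

Lemma der1 : D 1 = 0.
Proof.
by apply: (@addrI _ (D 1)); rewrite -{3}[1]mulr1 derD_mul mulr1 mul1r addr0.
Qed.

Lemma der_sum (I : Type) (r : seq I) (P : pred I) (G : I -> R) :
  D (\sum_(i <- r | P i) G i) = \sum_(i <- r | P i) D (G i).
Proof. exact: (big_morph D derD_add der0). Qed.

Lemma derX x n : D (x ^+ n.+1) = x ^+ n * D x *+ n.+1.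
Proof.
elim: n => [|n IHn]; first by rewrite expr1 expr0 mul1r mulr1n.
by rewrite exprS derD_mul IHn mulrnAr mulrA -exprS [D x * _]mulrC -mulrS.
Qed.

Lemma der_iter_sum (I : Type) (r : seq I) (P : pred I) (G : I -> R) i :
  iter i D (\sum_(j <- r | P j) G j) = \sum_(j <- r | P j) iter i D (G j).
Proof. by elim: i => //= i ->; rewrite der_sum. Qed.

Lemma der_iter_const c x i : D c = 0 -> iter i D (c * x) = c * iter i D x.
Proof. by move=> c0; elim: i => //= i ->; rewrite derD_mul c0 mul0r add0r. Qed.

End Derivation.

Lemma der_div (F : fieldType) (D : F -> F) (derD : derivation D) x y :
  y != 0 -> D (x / y) = (D x * y - x * D y) / y ^+ 2.
Proof.
move=> y0; have: D x = D (x / y) * y + x / y * D y.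
  by rewrite -derD_mul // divfK.
by move=> ->; field.
Qed.

Lemma tofrac_inj (R : idomainType) : injective (@FracField.tofrac R).
Proof. by move=> a b /eqP; rewrite tofrac_eq => /eqP. Qed.

Section FracLift.
Variables (R : idomainType) (F : fieldType) (phi : {rmorphism R -> F}).
Hypothesis phi_inj : injective phi.

Lemma fracE (x : {fraction R}) :
  x = (\n_(repr x))%:F / (\d_(repr x))%:F.
Proof.
by rewrite -frac_numden mulrAC divff ?mul1r // tofrac_eq0 denom_ratioP.
Qed.

Lemma fracP (x : {fraction R}) : exists a b : R, b != 0 /\ x = a%:F / b%:F.
Proof.
by exists \n_(repr x), \d_(repr x); rewrite denom_ratioP; split; last exact: fracE.
Qed.

Lemma frac_cross (a b c d : R) : b != 0 -> d != 0 ->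
  a%:F / b%:F = c%:F / d%:F -> a * d = c * b.
Proof.
move=> b0 d0 /eqP; rewrite eqr_div ?tofrac_eq0 // -!tofracM tofrac_eq.
exact: eqP.
Qed.

Let phi_neq0 z : z != 0 -> phi z != 0.
Proof. by rewrite -(inj_eq phi_inj) rmorph0. Qed.

(** The extension of an injective morphism to the field of fractions; the proof
  of injectivity is an argument because the extension is a morphism only then.
*)
Definition frac_lift of injective phi := fun x : {fraction R} =>
  phi \n_(repr x) / phi \d_(repr x).
Local Notation lift := (frac_lift phi_inj).

Lemma frac_lift_div a b : b != 0 -> lift (a%:F / b%:F) = phi a / phi b.
Proof.
move=> b0; have d0 := denom_ratioP (repr (a%:F / b%:F)).
have /(frac_cross b0 d0) := fracE (a%:F / b%:F).
move=> e; rewrite /frac_lift; apply/eqP.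
by rewrite eqr_div ?phi_neq0 // -!rmorphM /= e.
Qed.

Lemma frac_lift_tofrac a : lift a%:F = phi a.
Proof.
by rewrite -[a%:F]divr1 -tofrac1 frac_lift_div ?oner_eq0 // rmorph1 divr1.
Qed.

Lemma frac_lift_zmod : zmod_morphism lift.
Proof.
move=> x y; have [[a [b [b0 ->]]] [c [d [d0 ->]]]] := (fracP x, fracP y).
have bd0 : b * d != 0 by rewrite mulf_neq0.
rewrite -mulNr addf_div ?tofrac_eq0 // -tofracN -!tofracM -tofracD.
rewrite !frac_lift_div // rmorphD !rmorphM rmorphN /= -mulNr.
by rewrite addf_div ?phi_neq0.
Qed.

Lemma frac_lift_monoid : monoid_morphism lift.
Proof.
split=> [|x y]; first by rewrite -tofrac1 frac_lift_tofrac rmorph1.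
have [[a [b [b0 ->]]] [c [d [d0 ->]]]] := (fracP x, fracP y).
have bd0 : b * d != 0 by rewrite mulf_neq0.
rewrite mulf_div -!tofracM !frac_lift_div // !rmorphM /=.
by rewrite mulf_div.
Qed.

HB.instance Definition _ :=
  GRing.isZmodMorphism.Build _ _ (frac_lift phi_inj) frac_lift_zmod.
HB.instance Definition _ :=
  GRing.isMonoidMorphism.Build _ _ (frac_lift phi_inj) frac_lift_monoid.

End FracLift.

Lemma quotient_rule_add (F : fieldType) (a b c e a' b' c' e' : F) :
  b != 0 -> e != 0 ->
  ((a' * e + a * e' + (c' * b + c * b')) * (b * e)
     - (a * e + c * b) * (b' * e + b * e')) / (b * e) ^+ 2 =
  (a' * b - a * b') / b ^+ 2 + (c' * e - c * e') / e ^+ 2.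
Proof. by move=> b0 e0; field; rewrite b0 e0. Qed.

Lemma quotient_rule_mul (F : fieldType) (a b c e a' b' c' e' : F) :
  b != 0 -> e != 0 ->
  ((a' * c + a * c') * (b * e) - a * c * (b' * e + b * e')) / (b * e) ^+ 2 =
  (a' * b - a * b') / b ^+ 2 * (c / e) + a / b * ((c' * e - c * e') / e ^+ 2).
Proof. by move=> b0 e0; field; rewrite b0 e0. Qed.

Section FracDer.
Variables (R : idomainType) (d : R -> R).
Hypothesis der_d : derivation d.

Definition frac_der (x : {fraction R}) : {fraction R} :=
  let a := \n_(repr x) in let b := \d_(repr x) in
  (d a * b - a * d b)%:F / (b ^+ 2)%:F.

Lemma frac_der_div a b : b != 0 ->
  frac_der (a%:F / b%:F) = (d a * b - a * d b)%:F / (b ^+ 2)%:F.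
Proof.
move=> b0; have c0 := denom_ratioP (repr (a%:F / b%:F)).
have /(frac_cross b0 c0) := fracE (a%:F / b%:F).
rewrite /frac_der; set a' := \n_ _; set b' := \d_ _ => e.
have de : d a * b' + a * d b' = d a' * b + a' * d b.
  by rewrite -!(derD_mul der_d) e.
apply/eqP; rewrite eqr_div ?tofrac_eq0 ?sqrf_eq0 // -!tofracM tofrac_eq.
apply/eqP; have -> : (d a' * b' - a' * d b') * b ^+ 2 =
  b * b' * (d a' * b + a' * d b) - d b' * b * (a' * b) - b' * d b * (a' * b) by ring.
rewrite -de -e; ring.
Qed.

Lemma frac_der_tofrac a : frac_der a%:F = (d a)%:F.
Proof.
rewrite -[a%:F]divr1 -tofrac1 frac_der_div ?oner_eq0 //.
by rewrite (der1 der_d) mulr0 subr0 mulr1 expr1n tofrac1 divr1.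
Qed.

Lemma frac_derP : derivation frac_der.
Proof.
split=> x y; have [[a [b [b0 ->]]] [c [e [e0 ->]]]] := (fracP x, fracP y).
  have be0 : b * e != 0 by rewrite mulf_neq0.
  rewrite addf_div ?tofrac_eq0 // -!tofracM -!tofracD !frac_der_div //.
  rewrite (derD_add der_d) !(derD_mul der_d).
  rewrite !(tofracN, tofracM, tofracD, tofracXn).
  by apply: quotient_rule_add; rewrite tofrac_eq0.
have be0 : b * e != 0 by rewrite mulf_neq0.
rewrite mulf_div -!tofracM !frac_der_div // !(derD_mul der_d).
rewrite !(tofracN, tofracM, tofracD, tofracXn).
by apply: quotient_rule_mul; rewrite tofrac_eq0.
Qed.

Lemma frac_lift_der (F : fieldType) (phi : {rmorphism R -> F})
    (phi_inj : injective phi) (D : F -> F) : derivation D ->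
    (forall a, phi (d a) = D (phi a)) ->
  forall x, frac_lift phi_inj (frac_der x) = D (frac_lift phi_inj x).
Proof.
move=> derD dD x; have [a [b [b0 ->]]] := fracP x.
have b20 : b ^+ 2 != 0 by rewrite expf_neq0.
rewrite frac_der_div // !frac_lift_div // (der_div derD) -?(rmorph0 phi) ?(inj_eq phi_inj) //.
by rewrite rmorphXn rmorphB !rmorphM /= !dD.
Qed.

End FracDer.

Lemma poly_derivation (R : comNzRingType) : derivation (@deriv R).
Proof. by split=> p q; [exact: derivD | exact: derivM]. Qed.

Lemma fps_derivation (F : comNzRingType) : derivation (@fps_deriv F).
Proof. by split=> p q; [exact: fps_derivD | exact: fps_derivM]. Qed.

(** * Hensel's lemma *)

Lemma size_predS (R : nzSemiRingType) (p : {poly R}) :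
  p != 0 -> size p = (size p).-1.+1.
Proof. by rewrite -size_poly_gt0 => /prednK. Qed.

Ltac size_lia :=
  repeat match goal with |- context [@size ?T ?s] => move: (@size T s) => ? end;
  lia.

Lemma course_of_values (T : Type) (step : seq T -> T) :
  exists g : nat -> T, forall n, g n = step (mkseq g n).
Proof.
pose S n := iter n (fun s => rcons s (step s)) [::].
exists (fun n => step (S n)) => n; congr step.
by elim: n => // n IHn; rewrite mkseqS -IHn.
Qed.

Section Hensel.
Variable C : fieldType.
Implicit Types (h G H : {poly fps C}) (p q e : {poly C}).

(** A polynomial in y over power series in u is also a power series in u over
  polynomials in y; these are its coefficients. *)
Definition slice k h : {poly C} := map_poly (fun f : fps C => f k) h.

Lemma sliceE k h i : (slice k h)`_i = h`_i k.
Proof. by rewrite coef_map_id0. Qed.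

Lemma slice_inj G H : (forall k, slice k G = slice k H) -> G = H.
Proof.
by move=> GH; apply/polyP => i; apply/funext=> k; rewrite -!sliceE GH.
Qed.

Lemma sliceM k G H :
  slice k (G * H) = \sum_(l < k.+1) slice l G * slice (k - l)%N H.
Proof.
apply/polyP => i; rewrite sliceE coefM fps_sumE coef_sum.
under [RHS]eq_bigr do rewrite coefM.
rewrite [RHS]exchange_big /=; apply: eq_bigr => j _. rewrite fpsM.
by apply: eq_bigr => l _; rewrite !sliceE.
Qed.

Lemma monic_slice n G : G \is monic -> size G = n.+1 ->
  slice 0 G \is monic /\ size (slice 0 G) = n.+1.
Proof.
move=> /monicP Gm sG; have Gn : (slice 0 G)`_n = 1.
  by rewrite sliceE -[n]/(n.+1.-1) -sG -lead_coefE Gm fps1E.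
have sG0 : size (slice 0 G) = n.+1.
  apply/eqP; rewrite eqn_leq; apply/andP; split.
    by rewrite -sG; apply: size_poly.
  by rewrite ltnNge; apply/negP => /leq_sizeP/(_ n (leqnn n))/eqP; rewrite Gn oner_eq0.
by split=> //; rewrite monicE lead_coefE sG0 /= Gn.
Qed.

Lemma monic_slice_gt n G k : G \is monic -> size G = n.+1 ->
  (0 < k)%N -> (size (slice k G) <= n)%N.
Proof.
move=> /monicP Gm sG k0; apply/leq_sizeP => i; rewrite leq_eqVlt sliceE.
case/predU1P=> [<-|lt_ni]; last by rewrite nth_default // sG.
by rewrite -[n]/(n.+1.-1) -sG -lead_coefE Gm fps1E gtn_eqF.
Qed.

(** The linearized lifting problem: reduce a Bezout solution modulo p. *)
Lemma bezout_sizes p q e : coprimep p q -> p != 0 -> q != 0 ->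
  (size e < (size p + size q).-1)%N ->
  exists ab : {poly C} * {poly C},
    [/\ ab.1 * q + p * ab.2 = e, (size ab.1 < size p)%N &
        (size ab.2 < size q)%N].
Proof.
move=> /Bezout_eq1_coprimepP[[u v] /= uv] p0 q0 se.
pose a := (v * e) %% p; have sa : (size a < size p)%N by rewrite ltn_modp.
pose b := u * e + (v * e) %/ p * q.
have eb : e - a * q = b * p.
  have -> : a = v * e - (v * e) %/ p * p 
    by apply/eqP; rewrite eq_sym subr_eq addrC -divp_eq.
  have ue : (u * p + v * q) * e = e by rewrite uv mul1r.
  by rewrite /b; move: (_ %/ _) => k; rewrite -{1}ue; ring.
exists (a, b); split=> //=; first by rewrite mulrC [p * b]mulrC -eb mulrC addrC subrK.
have [->|b0] := eqVneq b 0; first by rewrite size_poly0 size_poly_gt0.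
have: (size (e - a * q)%R < (size p + size q).-1)%N.
  apply: leq_ltn_trans (size_polyD _ _) _; rewrite size_polyN gtn_max se /=.
  apply: leq_ltn_trans (size_polyMleq _ _) _.
  by move: p0 q0 sa; rewrite -!size_poly_gt0; size_lia.
rewrite eb size_mul //; move: p0 q0 b0; rewrite -!size_poly_gt0; size_lia.
Qed.

(** Sequences of polynomials define monic polynomials over power series when
  their degrees are bounded; the lifted factors of [hensel] are obtained so. *)
Lemma poly_of_slices n (g : nat -> {poly C}) :
  g 0%N \is monic -> size (g 0%N) = n.+1 ->
  (forall k, (size (g k.+1) <= n)%N) ->
  exists G, [/\ G \is monic, size G = n.+1 & forall k, slice k G = g k].
Proof.
move=> g0m sg0 sg; pose G := \poly_(i < n.+1) ((fun k => (g k)`_i) : fps C).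
have gn : ((fun k => (g k)`_n) : fps C) = 1.
  apply/funext=> -[|k]; last by rewrite fps1E (leq_sizeP _ _ (sg k)).
  by rewrite fps1E -[n]/(n.+1.-1) -sg0 -lead_coefE (monicP g0m).
exists G; split.
- by rewrite monicE lead_coef_poly //= gn ?oner_eq0.
- by rewrite size_poly_eq //= gn oner_eq0.
move=> k; apply/polyP => i; rewrite sliceE coef_poly.
case: ltnP => // lt_ni; rewrite nth_default //; apply: leq_trans lt_ni.
by case: k => [|k]; [rewrite sg0 | apply: leqW].
Qed.

(** The coefficients of u^k in the two factors are computed by recursion on k:
  given the preceding ones, they solve a linear equation a q + p b = e, where
  coprimality provides the solution, and the degrees of a and b are less than
  those of p and q, so that the factors stay monic. *)
Theorem hensel h p q n : h \is monic -> size h = n.+1 ->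
    p \is monic -> q \is monic -> coprimep p q ->
    slice 0 h = p * q ->
  exists G H, [/\ G \is monic, H \is monic, size G = size p,
                  size H = size q & h = G * H].
Proof.
move=> hm sh pm qm cpq h0; have [p0 q0] := (monic_neq0 pm, monic_neq0 qm).
have spq : n = ((size p).-1 + (size q).-1)%N.
  have [_] := monic_slice hm sh; rewrite h0 size_mul //.
  by move: p0 q0; rewrite -!size_poly_gt0; size_lia.
(* The sizes of a and b are controlled only when that of e is at most n. *)
pose good e (ab : {poly C} * {poly C}) := (size e <= n)%N ->
  [/\ ab.1 * q + p * ab.2 = e, (size ab.1 < size p)%N & (size ab.2 < size q)%N].
have /choice[sol solP] : forall e, exists ab, good e ab.
  move=> e; have [se|se] := leqP (size e) n; last first.
    by exists (0, 0); rewrite /good leqNgt se.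
  have [|ab abP] := @bezout_sizes p q e cpq p0 q0; last by exists ab.
  by move: p0 q0 se spq; rewrite -!size_poly_gt0; size_lia.
pose step (s : seq ({poly C} * {poly C})) :=
  if size s is k.+1 then
    sol (slice k.+1 h - \sum_(l < k) (nth 0 s l.+1).1 * (nth 0 s (k - l)%N).2)
  else (p, q).
have [g gE] := course_of_values step.
have g0 : g 0%N = (p, q) by rewrite gE.
have gS k : g k.+1 = sol (slice k.+1 h - \sum_(l < k) (g l.+1).1 * (g (k - l)%N).2).
  rewrite gE /step size_mkseq; congr (sol (_ - _)); apply: eq_bigr => l _.
  rewrite !nth_mkseq //; first by rewrite ltnS leq_subr.
  by rewrite ltnS.
have sg k : [/\ (g k.+1).1 * q + p * (g k.+1).2 =
    slice k.+1 h - \sum_(l < k) (g l.+1).1 * (g (k - l)%N).2,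
    (size (g k.+1).1 < size p)%N & (size (g k.+1).2 < size q)%N].
  elim/ltn_ind: k => k IHk; rewrite gS; apply: solP.
  apply: leq_trans (size_polyD _ _) _; rewrite geq_max monic_slice_gt //=.
  rewrite size_polyN; apply: leq_trans (size_sum _ _ _) _.
  apply/bigmax_leqP => l _; apply: leq_trans (size_polyMleq _ _) _.
  have [_ s1 _] := IHk l (ltn_ord l).
  have ltkl : (k - l.+1 < k)%N by have := ltn_ord l; lia.
  have [_ _] := IHk _ ltkl; rewrite -subSn // subSS => s2.
  by move: p0 q0 s1 s2 spq; rewrite -!size_poly_gt0; size_lia.
have [|||G [Gm sG GE]] := @poly_of_slices (size p).-1 (fun k => (g k).1).
- by rewrite g0.
- by rewrite g0 -size_predS.
- by move=> k; have [_ ? _] := sg k; rewrite -ltnS -size_predS.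
have [|||H [Hm sH HE]] := @poly_of_slices (size q).-1 (fun k => (g k).2).
- by rewrite g0.
- by rewrite g0 -size_predS.
- by move=> k; have [_ _ ?] := sg k; rewrite -ltnS -size_predS.
exists G, H; split=> //; rewrite ?sG ?sH -?size_predS //.
apply: slice_inj => k; rewrite sliceM; under eq_bigr do rewrite GE HE.
case: k => [|k]; first by rewrite big_ord1 g0.
have [e _ _] := sg k; rewrite big_ord_recl big_ord_recr /= subn0 subnn g0 /=.
under eq_bigr do rewrite /bump add1n subSS.
by rewrite addrCA [p * _ + _]addrC e addrC subrK.
Qed.

End Hensel.

(** * Puiseux's theorem *)

(** The coefficients are multiplied, not divided, by powers of w, which need not
  be invertible. *)
Lemma prod_XsubC_scale (R : comNzRingType) (w : R) rs i : (i <= size rs)%N ->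
  (\prod_(r <- rs) ('X - (w * r)%:P))`_i =
  w ^+ (size rs - i) * (\prod_(r <- rs) ('X - r%:P))`_i.
Proof.
elim: rs i => [|r rs IH] i /=.
  by rewrite leqn0 => /eqP->; rewrite !big_nil subnn mul1r.
rewrite !big_cons !mulrBl !coefB !coefXM !coefCM.
case: i => [_|i] /=.
  by rewrite IH // !sub0r subn0 [in RHS]exprS; ring.
rewrite ltnS subSS => le_i; rewrite IH //; move: le_i; rewrite leq_eqVlt.
case/predU1P=> [->|lt_i]; last by rewrite IH // -(subnSK lt_i) exprS; ring.
by rewrite ![_`_(size rs).+1]nth_default ?size_prod_XsubC //; ring.
Qed.

Lemma monic_size1 (R : nzSemiRingType) (p : {poly R}) :
  p \is monic -> size p = 1 -> p = 1.
Proof.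
move=> /monicP pm sp; rewrite (size1_polyC (eq_leq sp)).
by move: pm; rewrite lead_coefE sp => ->.
Qed.

Section Puiseux.
Variable C : numClosedFieldType.
Implicit Types (h G H : {poly fps C}) (f : fps C).

Definition fps_const (a : C) : fps C := fps_of a%:P.

Lemma fps_const_mul_nat n a : a *+ n = 1 -> fps_const a *+ n = 1.
Proof. by move=> an; rewrite -rmorphMn -polyCMn an rmorph1. Qed.

(** Tschirnhaus's translation: the sum of the roots becomes 0, which needs
  characteristic 0. *)
Lemma tschirnhaus n G : G \is monic -> size G = n.+2 ->
  exists b, [/\ (G \Po ('X + b%:P)) \is monic, size (G \Po ('X + b%:P)) = n.+2
             & (G \Po ('X + b%:P))`_n = 0].
Proof.
move=> Gm sG; pose b := - (fps_const n.+1%:R^-1 * G`_n); exists b.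
have Xb : 'X + b%:P = 'X - (- b)%:P by rewrite polyCN opprK.
have sX : size ('X + b%:P) = 2 by rewrite size_XaddC.
have Gn1 : G`_n.+1 = 1 by rewrite -(monicP Gm) lead_coefE sG.
split.
- rewrite monicE lead_coef_comp ?sX // (monicP Gm) mul1r Xb lead_coefXsubC.
  by rewrite expr1n.
- by rewrite size_comp_poly2.
have Xn i : ('X + b%:P) ^+ i = \prod_(r <- nseq i (- b)) ('X - r%:P).
  by rewrite Xb big_nseq; elim: i => // i IHi; rewrite exprS IHi.
rewrite coef_comp_poly sG 2!big_ord_recr /= big1 ?add0r => [|i _]; last first.
  by rewrite [X in _ * X]nth_default ?mulr0 // Xn size_prod_XsubC size_nseq.
have -> : (('X + b%:P) ^+ n)`_n = 1.
  have := monic_prod_XsubC (nseq n (- b)) xpredT id.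
  by rewrite monicE lead_coefE size_prod_XsubC size_nseq -Xn => /eqP.
have := @coefPn_prod_XsubC _ (nseq n.+1 (- b)).
rewrite size_nseq -Xn => -> //.
rewrite big_nseq iter_addr addr0 mulr1 Gn1 mul1r mulNrn opprK mulNrn -mulrnAl.
rewrite fps_const_mul_nat ?mul1r ?subrr //.
by rewrite -mulr_natr mulVf // pnatr_eq0.
Qed.

(** The Newton polygon: the least slope p/q makes all the coefficients of
  u^(-pn) G(u^q, u^p y) power series, one of them with a nonzero constant
  coefficient.  The integer called q in the conclusion is the predecessor of
  this denominator, as [fps_subst] requires. *)
Lemma newton_slope n G : G \is monic -> size G = n.+1 -> G != 'X^n ->
  exists q p h, [/\ h \is monic, size h = n.+1,
    exists2 i0, (i0 < n)%N & h`_i0 0%N != 0 &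
    forall i, (i <= n)%N ->
      fps_subst q G`_i = fps_of 'X^(p * (n - i)) * h`_i].
Proof.
move=> Gm sG Gn; have Gn1 : G`_n = 1 by rewrite -(monicP Gm) lead_coefE sG.
have [i1 Gi1] : exists i : 'I_n, G`_i != 0.
  apply: contrapT => /forallNP Gi; case/eqP: Gn; apply/polyP => i.
  rewrite coefXn; case: (ltngtP i n) => [lt_in|lt_ni|->//].
  - by have /negP/negPn/eqP := Gi (Ordinal lt_in).
  - by rewrite nth_default // sG.
have /choice[og ogE] : forall i : nat, exists og : nat * fps C,
    G`_i != 0 -> og.2 0%N != 0 /\ G`_i = fps_of 'X^(og.1) * og.2.
  move=> i; have [_|/fps_factor[m [g g0 ->]]] := eqVneq G`_i 0.
    by exists (0%N, 0).
  by exists (m, g).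
pose o i := (og i).1; pose slope (i : 'I_n) : rat := (o i)%:R / (n - i)%:R.
have [i0 Gi0 min_i0] := Order.TotalTheory.arg_minP (P := fun i : 'I_n => G`_i != 0) slope Gi1.
pose q := (n - i0)%N; pose p := o i0.
have q0 : (0 < q)%N by rewrite subn_gt0.
have le_o i : (i < n)%N -> G`_i != 0 -> (p * (n - i) <= q * o i)%N.
  move=> lt_in Gi; have := min_i0 (Ordinal lt_in) Gi.
  rewrite /slope ler_pdivrMr ?ltr0n ?subn_gt0 //.
  rewrite mulrAC ler_pdivlMr ?ltr0n ?subn_gt0 //.
  by rewrite -!natrM ler_nat /= [(o i * _)%N]mulnC.
pose hc i : fps C := if i == n then 1 else if G`_i == 0 then 0 else
  fps_of 'X^(q * o i - p * (n - i)) * fps_subst q.-1 (og i).2.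
have hcn : hc n = 1 by rewrite /hc eqxx.
pose h := \poly_(i < n.+1) hc i.
have hE i : (i < n)%N -> h`_i = if G`_i == 0 then 0 else
  fps_of 'X^(q * o i - p * (n - i)) * fps_subst q.-1 (og i).2.
  by move=> lt_in; rewrite coef_poly ltnS ltnW // /hc ltn_eqF.
exists q.-1, p, h; split.
- by rewrite monicE lead_coef_poly //= hcn ?oner_eq0.
- by rewrite size_poly_eq //= hcn oner_eq0.
- exists i0 => //; rewrite hE // (negPf Gi0).
  rewrite [(p * _)%N]mulnC subnn expr0 rmorph1 mul1r.
  by rewrite /fps_subst dvdn0 div0n; case: (ogE i0 Gi0).
move=> i; rewrite leq_eqVlt => /predU1P[->|lt_in].
  by rewrite Gn1 rmorph1 subnn muln0 expr0 rmorph1 mul1r coef_poly leqnn hcn.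
rewrite hE //; have [->|Gi] := eqVneq G`_i 0; first by rewrite rmorph0 mulr0.
have [_ ->] := ogE i Gi; rewrite rmorphM /= fps_subst_of prednK // mulrA -rmorphM /=.
by rewrite comp_Xn_poly -exprD -exprM subnKC // le_o.
Qed.

(** In characteristic 0, a power of X - c whose subleading coefficient vanishes is
  a power of X.  So p has at least two distinct roots, and the power of X - c
  that divides it, for any root c, is coprime to its cofactor. *)
Lemma closed_coprime_factors n (p : {poly C}) : p \is monic -> size p = n.+2 ->
    p`_n = 0 -> p != 'X^(n.+1) ->
  exists a b : {poly C}, [/\ a \is monic, b \is monic, coprimep a b, p = a * b
    & (size a < n.+2)%N /\ (size b < n.+2)%N].
Proof.
move=> pm sp pn pX; have p0 := monic_neq0 pm.
have /closed_rootP[c pc] : size p != 1 by rewrite sp.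
have [m [q]] := multiplicity_XsubC p c; rewrite p0 /= => qc ep.
have Xm : ('X - c%:P) ^+ m \is monic by rewrite monic_exp // monicXsubC.
have qm : q \is monic by rewrite -(monicMr q Xm) -ep.
have m0 : (0 < m)%N.
  by case: m ep {Xm} => // ep; case/negP: qc; rewrite -[q]mulr1 -ep.
have es : (n.+1 = m + (size q).-1)%N.
  move: sp; rewrite ep size_monicM ?monic_neq0 // size_exp_XsubC.
  by have := monic_neq0 qm; rewrite -size_poly_gt0; size_lia.
exists q, (('X - c%:P) ^+ m); split=> //.
- by rewrite coprimep_expr // coprimep_XsubC.
rewrite size_exp_XsubC; split.
  by move: es m0; size_lia.
rewrite ltnS ltn_neqAle andbC -ltnS es ltnS leq_addr /=.
apply/negP => /eqP em; case/eqP: pX.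
have q1 : q = 1.
  apply: monic_size1 => //.
  by move: es em (monic_neq0 qm); rewrite -size_poly_gt0; size_lia.
move: ep; rewrite q1 mul1r => ep.
have {}em : m = n.+1 by move: es; rewrite q1 size_poly1 addn0.
have Xe i : ('X - c%:P) ^+ i = \prod_(r <- nseq i c) ('X - r%:P).
  by rewrite big_nseq; elim: i => // i IHi; rewrite exprS IHi.
have := @coefPn_prod_XsubC _ (nseq n.+1 c).
rewrite size_nseq -Xe -em -ep em pn => /(_ isT) /esym/eqP.
rewrite big_nseq iter_addr addr0.
rewrite oppr_eq0 -mulr_natr mulf_eq0 pnatr_eq0 orbF => /eqP c0.
by rewrite ep em c0 subr0.
Qed.

Lemma fps_ofXn_neq0 (F : fieldType) m : (fps_of 'X^m : fps F) != 0.
Proof.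
rewrite -(rmorph0 (@fps_of F)) (inj_eq (@fps_of_inj F)).
by rewrite -size_poly_eq0 size_polyXn.
Qed.

Lemma map_poly_fps_subst_comp N N' G :
  map_poly (fps_subst N) (map_poly (fps_subst N') G) =
  map_poly (fps_subst (N.+1 * N'.+1).-1) G.
Proof. by apply/polyP => i; rewrite !coef_map /= fps_subst_comp. Qed.

(** Translation, scaling by the least slope and reduction modulo u yield a
  polynomial with coprime factors, which Hensel's lemma lifts.  The ramification
  indices of the scaling and of the two factors multiply. *)
Theorem puiseux n G : G \is monic -> size G = n.+1 ->
  exists N (rs : seq (fps C)),
    map_poly (fps_subst N) G = \prod_(r <- rs) ('X - r%:P).
Proof.
elim/ltn_ind: n G => -[|n] IHn G Gm sG.
  exists 0%N, [::]; rewrite big_nil; by rewrite (monic_size1 Gm sG) rmorph1.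
have [b [Gbm sGb Gbn]] := tschirnhaus Gm sG; set Gb := G \Po _ in Gbm sGb Gbn.
suff [N [rs Gbrs]] : exists N (rs : seq (fps C)),
    map_poly (fps_subst N) Gb = \prod_(r <- rs) ('X - r%:P).
  exists N, (map (fun r => r + fps_subst N b) rs).
  have -> : G = Gb \Po ('X - b%:P).
    by rewrite -comp_polyA comp_polyD comp_polyX comp_polyC subrK comp_polyXr.
  rewrite map_comp_poly Gbrs rmorphB /= map_polyX map_polyC big_map.
  rewrite rmorph_prod /=; apply: eq_bigr => r _.
  by rewrite rmorphB /= comp_polyX comp_polyC polyCD; ring.
have [->|GbX] := eqVneq Gb 'X^(n.+1).
  exists 0%N, (nseq n.+1 0); rewrite map_polyXn big_nseq subr0.
  by elim: n.+1 => // k IHk; rewrite exprS IHk.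
have [q [p [h [hm sh [i0 lt_i0 hi0] hE]]]] := newton_slope Gbm sGb GbX.
have [h0m sh0] := monic_slice hm sh.
have h0n : (slice 0 h)`_n = 0.
  have := hE n (leqnSn n); rewrite Gbn rmorph0 => /esym/eqP.
  by rewrite sliceE mulf_eq0 (negPf (fps_ofXn_neq0 _ _)) => /eqP->.
have h0X : slice 0 h != 'X^(n.+1).
  apply/eqP => e; move: hi0; rewrite -sliceE e coefXn.
  by rewrite ltn_eqF // eqxx.
have [a [c [am cm cac ac [sa sc]]]] := closed_coprime_factors h0m sh0 h0n h0X.
have [A [B [Am Bm sA sB hAB]]] := hensel hm sh am cm cac ac.
have szP (D : {poly fps C}) : D \is monic -> size D = (size D).-1.+1.
  by move/monic_neq0/size_predS.
have [|NA [ra Ara]] := IHn (size A).-1 _ A Am (szP A Am).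
  by rewrite -ltnS -(szP A Am) sA.
have [|NB [rb Brb]] := IHn (size B).-1 _ B Bm (szP B Bm).
  by rewrite -ltnS -(szP B Bm) sB.
pose M := (NA.+1 * NB.+1).-1; have eM : M.+1 = (NA.+1 * NB.+1)%N by [].
pose rs := map (fps_subst NB) ra ++ map (fps_subst NA) rb.
have hrs : map_poly (fps_subst M) h = \prod_(r <- rs) ('X - r%:P).
  rewrite hAB rmorphM /= big_cat !big_map -!map_prod_XsubC -Ara -Brb.
  by rewrite !map_poly_fps_subst_comp /M [(NB.+1 * _)%N]mulnC.
have srs : size rs = n.+1.
  apply: succn_inj; rewrite -(size_prod_XsubC rs id) -hrs -sh.
  exact/size_map_inj_poly/rmorph0/fps_subst_inj.
pose w : fps C := fps_of 'X^(M.+1 * p).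
exists (M.+1 * q.+1).-1, (map (fun r => w * r) rs).
rewrite -map_poly_fps_subst_comp big_map; apply/polyP => i.
have [le_in|lt_ni] := leqP i n.+1; last first.
  rewrite !nth_default ?size_prod_XsubC ?srs //.
  rewrite !(size_map_inj_poly (@fps_subst_inj _ _) (rmorph0 _)).
  by rewrite sGb.
rewrite !coef_map /= hE // rmorphM /= prod_XsubC_scale srs // -hrs coef_map /=.
rewrite fps_subst_of comp_Xn_poly -exprM; congr (_ * _).
by rewrite -rmorphXn /= -exprM mulnA.
Qed.

End Puiseux.

(** * Laurent series *)

Section Laurent.
Variable C : numClosedFieldType.
Implicit Types (f g : fps C).

Lemma fps_unitE f : f 0%N != 0 -> exists g, g * f = 1.
Proof.
move=> f0; pose step s := 
  (f 0%N)^-1 * ((size s == 0%N)%:R - \sum_(i < size s) nth 0 s i * f (size s - i)%N).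
have [g gE] := course_of_values step; exists g; apply/funext=> n.
rewrite fpsM fps1E big_ord_recr /= subnn gE /step size_mkseq [_^-1 * _]mulrC divfK //.
rewrite addrC (eq_bigr (fun i : 'I_n => g i * f (n - i)%N)) ?subrK // => i _.
by rewrite nth_mkseq.
Qed.

Definition laurent := {fraction (fps C)}.
HB.instance Definition _ := GRing.Field.on laurent.

Definition lu : laurent := (fps_of 'X)%:F.

Lemma luX m : lu ^+ m = (fps_of 'X^m)%:F :> laurent.
Proof. by rewrite !rmorphXn. Qed.

Lemma lu_neq0 : lu != 0.
Proof. by rewrite tofrac_eq0 -['X]expr1 fps_ofXn_neq0. Qed.

Lemma luX_neq0 m : lu ^+ m != 0. Proof. by rewrite expf_neq0 // lu_neq0. Qed.

Lemma laurentP (x : laurent) : exists m g, x * lu ^+ m = g%:F.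
Proof.
have [a [b [b0 ->]]] := fracP x; have [m [b' b'0 eb]] := fps_factor b0.
have [c cb] := fps_unitE b'0; exists m, (c * a).
have bF0 : b%:F != 0 by rewrite tofrac_eq0.
apply: (mulIf bF0); rewrite mulrAC divfK // luX -!tofracM; congr (_%:F).
rewrite eb (_ : c * a * _ = c * b' * (a * fps_of 'X^m)); last by ring.
by rewrite cb mul1r.
Qed.

Definition lsubst0 N : {rmorphism fps C -> laurent} :=
  @FracField.tofrac _ \o fps_subst N.

Lemma lsubst0_inj N : injective (lsubst0 N).
Proof. by move=> f g /eqP; rewrite /= tofrac_eq => /eqP/fps_subst_inj. Qed.

Definition lsubst N : {rmorphism laurent -> laurent} :=
  frac_lift (@lsubst0_inj N).

Lemma lsubst_tofrac N f : lsubst N f%:F = (fps_subst N f)%:F.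
Proof. exact: frac_lift_tofrac. Qed.

Lemma lsubst_lu N : lsubst N lu = lu ^+ N.+1.
Proof. by rewrite lsubst_tofrac luX fps_subst_of comp_polyX. Qed.

Definition lconst : {rmorphism C -> laurent} :=
  @FracField.tofrac _ \o @fps_of C \o polyC.

Lemma lsubst_const N a : lsubst N (lconst a) = lconst a.
Proof. by rewrite lsubst_tofrac fps_subst_of comp_polyC. Qed.

(** A common power of u, scaled into the roots, makes the coefficients power
  series. *)
Theorem puiseux_laurent n (Q : {poly laurent}) : Q \is monic -> size Q = n.+1 ->
  exists N rs, map_poly (lsubst N) Q = \prod_(r <- rs) ('X - r%:P).
Proof.
move=> Qm sQ; have Qn : Q`_n = 1 by rewrite -(monicP Qm) lead_coefE sQ.
have /choice[mg mgE] : forall i, exists mg : nat * fps C, Q`_i * lu ^+ mg.1 = mg.2%:F.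
  by move=> i; have [m [g e]] := laurentP Q`_i; exists (m, g).
pose m := \max_(i < n) (mg i).1.
pose c i : fps C := if (i < n)%N then
  fps_of 'X^(m * (n - i) - (mg i).1) * (mg i).2 else 1.
have cE i : (i <= n)%N -> Q`_i * lu ^+ (m * (n - i)) = (c i)%:F.
  rewrite /c leq_eqVlt => /predU1P[->|lt_in].
    by rewrite ltnn subnn muln0 expr0 mulr1 Qn tofrac1.
  rewrite lt_in tofracM -mgE -luX mulrCA -exprD subnK //.
  have le_m : ((mg i).1 <= m)%N.
    exact: (leq_bigmax (F := fun i : 'I_n => (mg i).1) (Ordinal lt_in)).
  by rewrite (leq_trans le_m) // leq_pmulr // subn_gt0.
pose G := \poly_(i < n.+1) c i.
have cn : c n = 1 by rewrite /c ltnn.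
have [||N [rs Grs]] := @puiseux C n G.
- by rewrite monicE lead_coef_poly //= cn ?oner_eq0.
- by rewrite size_poly_eq //= cn oner_eq0.
have sG : size G = n.+1 by rewrite size_poly_eq //= cn oner_eq0.
have srs : size rs = n.
  apply: succn_inj; rewrite -(size_prod_XsubC rs id) -Grs -[RHS]sG.
  exact/size_map_inj_poly/rmorph0/fps_subst_inj.
pose w := lu ^+ (N.+1 * m); have w0 : w != 0 by rewrite luX_neq0.
pose rsF : seq laurent := map (@FracField.tofrac _) rs.
have srsF : size rsF = n by rewrite size_map.
exists N, (map (fun r => w^-1 * r) rsF); rewrite big_map.
apply/polyP => i; have [le_in|lt_ni] := leqP i n; last first.
  rewrite !nth_default ?size_prod_XsubC ?srsF //.
  by rewrite (size_map_poly (lsubst N)) sQ.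
have eG : \prod_(r <- rsF) ('X - r%:P) =
    map_poly (@FracField.tofrac _) (map_poly (fps_subst N) G).
  by rewrite Grs map_prod_XsubC /rsF !big_map.
rewrite prod_XsubC_scale srsF // eG !coef_map /=.
rewrite coef_poly ltnS le_in.
apply: (mulIf (expf_neq0 (n - i) w0)); rewrite [RHS]mulrC mulrA -exprMn divff //.
rewrite expr1n mul1r -lsubst_tofrac -cE // rmorphM /=; congr (_ * _).
by rewrite rmorphXn lsubst_lu /w -!exprM mulnA.
Qed.

Definition zcoef f (i : int) : C := if i is Posz j then f j else 0.

Lemma zcoefX k f i : zcoef (fps_of 'X^k * f) i = zcoef f (i - k%:Z).
Proof.
case: i => [i|i] /=; last by rewrite /zcoef; case E: (_ - _) => //; lia.
rewrite fps_ofX_mulE /zcoef; case: ltnP => [lt_ik|le_ki].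
  by case E: (_ - _) => //; lia.
by rewrite subzn.
Qed.

(** The field of fractions has no canonical numerator, hence the choice of a
  power of u; [lcoefE] makes it irrelevant. *)
Definition lcoef (x : laurent) (i : int) : C :=
  let m := projT1 (cid (laurentP x)) in
  let g := projT1 (cid (projT2 (cid (laurentP x)))) in
  zcoef g (i + m%:Z).

Lemma lcoefE x m g i : x * lu ^+ m = g%:F -> lcoef x i = zcoef g (i + m%:Z).
Proof.
rewrite /lcoef; case: cid => m' ex /=; case: cid => g' /= e' e.
have -> : zcoef g' (i + m'%:Z) = zcoef (fps_of 'X^m * g') (i + m'%:Z + m%:Z).
  by rewrite zcoefX addrK.
have -> : zcoef g (i + m%:Z) = zcoef (fps_of 'X^m' * g) (i + m'%:Z + m%:Z).
  by rewrite zcoefX addrAC addrK.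
congr zcoef; apply/eqP; rewrite -tofrac_eq !tofracM -e -e' -!luX.
by apply/eqP; ring.
Qed.

Lemma lcoefD x y i : lcoef (x + y) i = lcoef x i + lcoef y i.
Proof.
have [m [f xf]] := laurentP x; have [n [g yg]] := laurentP y.
rewrite (@lcoefE x (m + n) (fps_of 'X^n * f)); last first.
  by rewrite exprD mulrA xf mulrC luX -tofracM.
rewrite (@lcoefE y (m + n) (fps_of 'X^m * g)); last first.
  by rewrite exprD mulrCA yg luX -tofracM.
rewrite (@lcoefE _ (m + n) (fps_of 'X^n * f + fps_of 'X^m * g)); last first.
  by rewrite tofracD !tofracM -xf -yg -!luX exprD; ring.
by rewrite /zcoef; case: (_ + _) => //; rewrite addr0.
Qed.

Lemma lcoef_inj x : (forall i, lcoef x i = 0) -> x = 0.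
Proof.
move=> x0; have [m [f xf]] := laurentP x; apply: (mulIf (luX_neq0 m)).
rewrite xf mul0r; apply/eqP; rewrite tofrac_eq0; apply/eqP/funext=> n.
by have := x0 (n%:Z - m%:Z); rewrite (lcoefE _ xf) subrK.
Qed.

Lemma lcoef0 i : lcoef 0 i = 0.
Proof. by rewrite (@lcoefE 0 0 0) ?mul0r ?tofrac0 // /zcoef; case: (_ + _). Qed.

Lemma lcoef_const a x i : lcoef (lconst a * x) i = a * lcoef x i.
Proof.
have [m [f xf]] := laurentP x; rewrite (lcoefE _ xf).
rewrite (@lcoefE _ m (fps_of a%:P * f)); last by rewrite -mulrA xf -tofracM.
by rewrite /zcoef; case: (_ + _) => [j|j]; rewrite ?mulr0 // fps_ofC_mulE.
Qed.

Lemma lcoef_luX k x i : lcoef (lu ^+ k * x) i = lcoef x (i - k%:Z).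
Proof.
have [m [f xf]] := laurentP x; rewrite (lcoefE _ xf).
rewrite (@lcoefE _ m (fps_of 'X^k * f)); first by rewrite zcoefX addrAC.
by rewrite -mulrA xf luX -tofracM.
Qed.

Lemma lcoef_bound x : exists m : nat, forall i, i < - m%:Z -> lcoef x i = 0.
Proof.
have [m [f xf]] := laurentP x; exists m => i lt_im; rewrite (lcoefE _ xf).
by rewrite /zcoef; case E: (_ + _) => //; lia.
Qed.

Definition lder : laurent -> laurent := frac_der (@fps_deriv C).

Lemma lder_derivation : derivation lder.
Proof. exact/frac_derP/fps_derivation. Qed.

Lemma lder_tofrac f : lder f%:F = (fps_deriv f)%:F.
Proof. exact/frac_der_tofrac/fps_derivation. Qed.

Lemma lder_const a : lder (lconst a) = 0.
Proof. by rewrite lder_tofrac fps_deriv_of derivC rmorph0 tofrac0. Qed.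

Lemma lder_lu : lder lu = 1.
Proof. by rewrite lder_tofrac fps_deriv_of derivX rmorph1 tofrac1. Qed.

Lemma lcoef_der x i : lcoef (lder x) i = (i + 1)%:~R * lcoef x (i + 1).
Proof.
have [m [f xf]] := laurentP x.
have xf1 : x * lu ^+ m.+1 = (fps_of 'X * f)%:F.
  by rewrite exprSr mulrA xf tofracM mulrC.
rewrite (@lcoefE _ m.+1 (fps_of 'X * fps_deriv f - fps_of (m%:R)%:P * f)); last first.
  rewrite tofracB !tofracM -xf -lder_tofrac -xf -[(fps_of 'X)%:F]/lu.
  rewrite (derD_mul lder_derivation).
  case: m {xf xf1} => [|m].
    by rewrite polyC0 rmorph0 tofrac0 !expr0 (der1 lder_derivation); ring.
  rewrite (derX lder_derivation) lder_lu -[(fps_of _)%:F]/(lconst m.+1%:R).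
  by rewrite rmorph_nat -mulr_natl !exprS; ring.
rewrite (lcoefE _ xf1) (_ : i + 1 + m.+1%:Z = i + m.+1%:Z + 1); last by lia.
have -> : (i + 1)%:~R = (i + m.+1%:Z)%:~R - m%:R :> C.
  by rewrite -[m%:R]/(m%:Z%:~R) -rmorphB /=; congr (_%:~R); lia.
move: (i + _) => j; rewrite -['X]expr1 zcoefX addrK expr1.
case: j => [j|j]; last by rewrite /= mulr0.
rewrite /zcoef fpsD fpsN fps_ofC_mulE mulrBl -['X]expr1 fps_ofX_mulE.
case: j => [|j] /=; first by rewrite mul0r.
by rewrite subn1 -pmulrn [j.+1%:R * _]mulr_natl.
Qed.

End Laurent.

(** * Conjugates of an algebraic element in a differential field *)

(** The morphism [iota] is kept apart from M, because the same operator acts on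
  several extensions of its ring of coefficients. *)
Definition op_apply (k K : comNzRingType) (iota : k -> K) (D : K -> K)
    (M : {poly k}) (x : K) :=
  \sum_(i < size M) iota M`_i * iter i D x.

Lemma op_apply_wide (k K : comNzRingType) (iota : k -> K) D n (M : {poly k}) x :
  iota 0 = 0 -> (size M <= n)%N ->
  op_apply iota D M x = \sum_(i < n) iota M`_i * iter i D x.
Proof.
move=> iota0 le_n; rewrite /op_apply.
rewrite (big_ord_widen _ (fun i => iota M`_i * iter i D x) le_n).
rewrite big_mkcond /=; apply: eq_bigr => i _; case: ltnP => // /(nth_default _) ->.
by rewrite iota0 mul0r.
Qed.

Section OpApplyMorphism.
Variables (k K : comNzRingType) (iota : {rmorphism k -> K}) (D : K -> K).
Implicit Types (M : {poly k}) (x : K).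

Lemma op_applyD M1 M2 x :
  op_apply iota D (M1 + M2) x = op_apply iota D M1 x + op_apply iota D M2 x.
Proof.
rewrite !(@op_apply_wide _ _ iota D (maxn (size M1) (size M2))) ?rmorph0 //.
- by rewrite -big_split; apply: eq_bigr => i _; rewrite coefD rmorphD mulrDl.
- by rewrite leq_maxr.
- by rewrite leq_maxl.
- exact: size_polyD.
Qed.

Lemma op_apply0 x : op_apply iota D 0 x = 0.
Proof. by rewrite /op_apply size_poly0 big_ord0. Qed.

Lemma op_apply_sum n (F : 'I_n -> {poly k}) x :
  op_apply iota D (\sum_i F i) x = \sum_i op_apply iota D (F i) x.
Proof.
apply: (big_morph (fun M => op_apply iota D M x)); last exact: op_apply0.
by move=> M1 M2; apply: op_applyD.
Qed.

Lemma op_applyCM a M x :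
  op_apply iota D (a%:P * M) x = iota a * op_apply iota D M x.
Proof.
rewrite (@op_apply_wide _ _ iota D (size M)) ?rmorph0 //.
  by rewrite mulr_sumr; apply: eq_bigr => i _; rewrite coefCM rmorphM mulrA.
by rewrite mul_polyC size_scale_leq.
Qed.

Lemma op_applyMX M x :
  op_apply iota D (M * 'X) x = \sum_(i < size M) iota M`_i * iter i.+1 D x.
Proof.
rewrite (@op_apply_wide _ _ iota D (size M).+1) ?rmorph0 //; last first.
  by have [->|M0] := eqVneq M 0; rewrite ?mul0r ?size_poly0 // size_mulX.
rewrite big_ord_recl coefMX rmorph0 mul0r add0r.
by apply: eq_bigr => i _; rewrite coefMX.
Qed.

Lemma op_apply_map (k' : comNzRingType) (phi : {rmorphism k' -> k}) (M : {poly k'}) x :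
  op_apply iota D (map_poly phi M) x = op_apply (iota \o phi) D M x.
Proof.
rewrite (@op_apply_wide _ _ iota D (size M)) ?rmorph0 ?size_poly //.
by apply: eq_bigr => i _; rewrite coef_map.
Qed.

End OpApplyMorphism.

Lemma op_apply_comb (k K : comNzRingType) (iota : k -> K) (D : K -> K) M n
    (c y : 'I_n -> K) : derivation D -> (forall j, D (c j) = 0) ->
  op_apply iota D M (\sum_j c j * y j) = \sum_j c j * op_apply iota D M (y j).
Proof.
move=> derD c0; rewrite /op_apply.
under [RHS]eq_bigr do rewrite mulr_sumr.
rewrite [RHS]exchange_big; apply: eq_bigr => i _ /=.
rewrite (der_iter_sum derD) mulr_sumr; apply: eq_bigr => j _.
by rewrite (der_iter_const derD) // mulrCA.
Qed.

(** The derivation of an extension of k, in terms of polynomials in an element x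
  with derivative h(x). *)
Definition delta (k : comNzRingType) (dk : k -> k) (h p : {poly k}) :=
  map_poly dk p + p^`() * h.

Section DiffExt.
Variables (k K : fieldType) (dk : k -> k) (D : K -> K).
Hypotheses (der_dk : derivation dk) (der_D : derivation D).
Variable iota : {rmorphism k -> K}.
Hypothesis iota_der : forall a, iota (dk a) = D (iota a).
Implicit Types (p q h M Q : {poly k}) (x : K).

Lemma coef_map_der p i : (map_poly dk p)`_i = dk p`_i.
Proof. by rewrite coef_map_id0 // der0. Qed.

Local Notation ev p x := (map_poly iota p).[x].

Lemma der_horner p x : D (ev p x) = ev (map_poly dk p) x + ev p^`() x * D x.
Proof.
elim/poly_ind: p => [|p c IHp].
  rewrite deriv0 !rmorph0 !horner0 mul0r addr0 (der0 der_D).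
  rewrite (_ : map_poly dk 0 = 0) ?rmorph0 ?horner0 //.
  by apply/polyP => i; rewrite coef_map_der coef0 der0.
rewrite (_ : map_poly dk (p * 'X + c%:P) = map_poly dk p * 'X + (dk c)%:P).
  rewrite derivD derivM derivX derivC !rmorphD !rmorphM /= !map_polyX !map_polyC.
  rewrite !hornerE (derD_add der_D) (derD_mul der_D) IHp /= iota_der rmorph1 rmorph0.
  by ring.
apply/polyP => i; rewrite coef_map_der !coefD !coefMX !coefC (derD_add der_dk).
by rewrite coef_map_der; case: ifP => // _; rewrite (der0 der_dk).
Qed.

Lemma iter_der_root h x i : D x = ev h x ->
  iter i D x = ev (iter i (delta dk h) 'X) x.
Proof.
move=> Dx; elim: i => [|i IHi] /=; first by rewrite map_polyX hornerX.
by rewrite IHi der_horner Dx /delta rmorphD rmorphM hornerD hornerM.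
Qed.

Lemma op_apply_root h M x : D x = ev h x ->
  op_apply iota D M x =
  ev (\sum_(i < size M) (M`_i)%:P * iter i (delta dk h) 'X) x.
Proof.
move=> Dx; rewrite /op_apply rmorph_sum horner_sum; apply: eq_bigr => i _.
by rewrite (iter_der_root i Dx) rmorphM /= map_polyC hornerM hornerC.
Qed.

(** Differentiating Q(x) = 0, where Q'(x) is inverted by a Bezout relation. *)
Lemma der_root a b Q x : a * Q + b * Q^`() = 1 -> root (map_poly iota Q) x ->
  D x = ev (- (b * map_poly dk Q)) x.
Proof.
move=> abQ /rootP Qx.
have /eqP : D (ev Q x) = 0 by rewrite Qx der0.
rewrite der_horner addrC addr_eq0 => /eqP eD.
have: ev (a * Q + b * Q^`()) x = 1 by rewrite abQ rmorph1 hornerE.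
rewrite rmorphD !rmorphM rmorphN !hornerE Qx mulr0 add0r => b1.
by rewrite -[D x]mul1r -b1 -mulrA eD rmorphM hornerM mulrN.
Qed.

End DiffExt.

Section MinPoly.
Variables (k K0 : fieldType) (dk : k -> k) (D0 : K0 -> K0).
Hypotheses (der_dk : derivation dk) (der_D0 : derivation D0).
Variable iota0 : {rmorphism k -> K0}.
Hypothesis iota0_der : forall a, iota0 (dk a) = D0 (iota0 a).
Hypothesis char0 : forall n, n.+1%:R != 0 :> k.
Variables (f : K0) (Q : {poly k}).
Hypotheses (Q_monic : Q \is monic) (Qf : root (map_poly iota0 Q) f).
Hypothesis Q_min : forall P : {poly k}, P != 0 -> root (map_poly iota0 P) f ->
  (size Q <= size P)%N.

Let Q0 : Q != 0. Proof. exact: monic_neq0. Qed.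

Lemma min_poly_dvd P : root (map_poly iota0 P) f -> Q %| P.
Proof.
move=> Pf; rewrite /dvdp; apply: contraT => R0.
have /Q_min : root (map_poly iota0 (P %% Q)) f.
  have : map_poly iota0 P = map_poly iota0 (P %/ Q * Q + P %% Q) by rewrite -divp_eq.
  rewrite rmorphD rmorphM /= => /(congr1 (horner^~ f)).
  by rewrite !hornerE (rootP Pf) (rootP Qf) mulr0 add0r => /esym/rootP.
by move/(_ R0); rewrite leqNgt ltn_modp Q0.
Qed.

Lemma size_min_poly : (1 < size Q)%N.
Proof.
rewrite ltnNge; apply/negP => /size1_polyC eQ; move: Q0 Qf.
by rewrite eQ map_polyC rootC polyC_eq0 fmorph_eq0 => /negPf->.
Qed.

(** A common factor of Q and Q' would be smaller than Q, as would its cofactor,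
  and one of them vanishes at f. *)
Lemma min_poly_separable : coprimep Q Q^`().
Proof.
have Q'0 : Q^`() != 0.
  have sQ := size_min_poly; apply/eqP => /(congr1 (fun p : {poly k} => p`_(size Q).-2)).
  rewrite coef_deriv coef0 prednK; last by rewrite -ltnS prednK // ltnW.
  rewrite -lead_coefE (monicP Q_monic); apply/eqP.
  by case: (size Q) sQ => [|[|n]] //= _; apply: char0.
set g := gcdp Q Q^`(); have gQ : g %| Q by rewrite dvdp_gcdl.
have gQ' : g %| Q^`() by rewrite dvdp_gcdr.
have g0 : g != 0 by rewrite gcdp_eq0 negb_and Q0.
have lt_g : (size g < size Q)%N.
  by apply: leq_ltn_trans (dvdp_leq Q'0 gQ') _; apply: lt_size_deriv.
rewrite coprimep_def -/g; apply: contraT => g1.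
have q0 : Q %/ g != 0 by rewrite dvdp_div_eq0.
have := Qf; rewrite -(divpK gQ) rmorphM rootM => /orP[] /Q_min.
  move=> /(_ q0); have : size Q = (size (Q %/ g) + size g).-1.
    by rewrite -{1}(divpK gQ) size_mul.
  by move: g1 g0 q0; rewrite -!size_poly_gt0; size_lia.
by move=> /(_ g0); rewrite leqNgt lt_g.
Qed.

Section Conjugates.
Variables (K : fieldType) (D : K -> K) (der_D : derivation D).
Variable iota : {rmorphism k -> K}.
Hypothesis iota_der : forall a, iota (dk a) = D (iota a).

(** By [op_apply_root], M(f) = 0 is a polynomial equation for f, hence divisible
  by Q, and the same polynomial gives M(c). *)
Theorem conjugate_solution M c : op_apply iota0 D0 M f = 0 ->
  root (map_poly iota Q) c -> op_apply iota D M c = 0.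
Proof.
have /Bezout_eq1_coprimepP[[a b] /= abQ] := min_poly_separable.
move=> Mf Qc; have Df := der_root der_dk der_D0 iota0_der abQ Qf.
have Dc := der_root der_dk der_D iota_der abQ Qc.
move: Mf; rewrite (op_apply_root der_dk der_D0 iota0_der _ Df) => /rootP.
rewrite (op_apply_root der_dk der_D iota_der _ Dc) => /min_poly_dvd/dvdpP[q ->].
by rewrite rmorphM hornerM (rootP Qc) mulr0.
Qed.

(** The reductions modulo Q of the polynomials that express the derivatives have
  a coefficient matrix of rank r, by minimality; the Vandermonde matrix of the
  roots, invertible since Q is separable, evaluates them. *)
Theorem conjugate_wronskian_rank r rs :
  (forall M, M != 0 -> op_apply iota0 D0 M f = 0 -> (r < size M)%N) ->
  map_poly iota Q = \prod_(c <- rs) ('X - c%:P) ->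
  \rank (\matrix_(i < r, j < size rs) iter i D rs`_j) = r.
Proof.
have /Bezout_eq1_coprimepP[[a b] /= abQ] := min_poly_separable.
move=> Mmin Qrs; set h := - (b * map_poly dk Q).
have Df : D0 f = (map_poly iota0 h).[f] := der_root der_dk der_D0 iota0_der abQ Qf.
have sQ : size Q = (size rs).+1.
  by rewrite -(size_prod_XsubC rs id) -Qrs size_map_poly.
pose p i := iter i (delta dk h) 'X %% Q.
pose A := \matrix_(i < r, l < size rs) (p i)`_l.
have A_free : row_free A.
  rewrite -kermx_eq0; apply/rowV0P => v /sub_kermxP vA.
  pose M := \poly_(i < r) (if insub i is Some i' then v 0 i' else 0).
  have Mi (i : 'I_r) : M`_i = v 0 i by rewrite coef_poly ltn_ord valK.
  have sM : (size M <= r)%N by apply: size_poly.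
  have dvdQ : Q %| \sum_(i < r) (M`_i)%:P * iter i (delta dk h) 'X.
    rewrite /dvdp (big_morph (fun g => g %% Q) (modpD Q) (mod0p Q)) -size_poly_leq0.
    apply/leq_sizeP => l _; rewrite coef_sum.
    have [lt_l|le_l] := ltnP l (size rs).
      have := congr1 (fun B : 'M_(1, _) => B 0 (Ordinal lt_l)) vA.
      rewrite !mxE => vl; rewrite -[RHS]vl; apply: eq_bigr => i _.
      by rewrite !mxE mul_polyC modpZl coefZ Mi.
    apply: big1 => i _; rewrite mul_polyC nth_default //; apply: leq_trans le_l.
    by rewrite -ltnS -sQ ltn_modp.
  have Mf : op_apply iota0 D0 M f = 0.
    rewrite (op_apply_wide _ _ (rmorph0 _) sM); case/dvdpP: dvdQ => q eq.
    have := congr1 (fun p => (map_poly iota0 p).[f]) eq.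
    rewrite rmorphM hornerM (rootP Qf) mulr0 => eq0; rewrite -[RHS]eq0.
    rewrite rmorph_sum horner_sum; apply: eq_bigr => i _.
    by rewrite (iter_der_root der_dk der_D0 iota0_der _ Df) rmorphM /= map_polyC hornerM hornerC.
  have [M0|M0] := eqVneq M 0.
    by apply/rowP => i; rewrite mxE -Mi M0 coef0.
  by have := Mmin _ M0 Mf; rewrite ltnNge sM.
have rs_uniq : uniq rs.
  rewrite -separable_prod_XsubC -Qrs separable_map unlock.
  exact: min_poly_separable.
pose V := Vandermonde (size rs) (\row_(j < size rs) rs`_j).
have V_free : row_free V.
  rewrite row_free_unit unitmxE det_Vandermonde unitfE.
  apply/prodf_neq0 => i _; apply/prodf_neq0 => j lt_ij; rewrite !mxE subr_eq0.
  by rewrite nth_uniq // gtn_eqF.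
rewrite -[RHS](eqP A_free) -(mxrank_map iota A) -(mxrankMfree _ V_free).
congr (\rank _); apply/matrixP => i j; rewrite !mxE.
have Qc : root (map_poly iota Q) rs`_j.
  by rewrite Qrs root_prod_XsubC mem_nth.
rewrite (iter_der_root der_dk der_D iota_der _
  (der_root der_dk der_D iota_der abQ Qc)) -/h.
have -> : (map_poly iota (iter i (delta dk h) 'X)).[rs`_j] = (map_poly iota (p i)).[rs`_j].
  rewrite {1}(divp_eq (iter i (delta dk h) 'X) Q) rmorphD rmorphM hornerD hornerM.
  by rewrite (rootP Qc) mulr0 add0r.
rewrite (@horner_coef_wide _ (size rs)); last first.
  by rewrite size_map_poly -ltnS -sQ ltn_modp.
by apply: eq_bigr => l _; rewrite coef_map !mxE.
Qed.

End Conjugates.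
End MinPoly.

(** * Linear operators on series with logarithms *)

Section LogOperator.
Implicit Types (p : {poly algC}) (q : nat -> algC) (b : algC).

(** The operator t d/dt on t^b q(log t), divided by t^b. *)
Definition euler b q : nat -> algC := fun k => b * q k + k.+1%:R * q k.+1.

Definition euler_poly p b q : nat -> algC :=
  fun k => \sum_(i < size p) p`_i * iter i (euler b) q k.

Lemma euler_poly_wide n p b q k : (size p <= n)%N ->
  euler_poly p b q k = \sum_(i < n) p`_i * iter i (euler b) q k.
Proof.
move=> le_n; rewrite /euler_poly.
rewrite (big_ord_widen _ (fun i => p`_i * iter i (euler b) q k) le_n).
rewrite big_mkcond /=; apply: eq_bigr => i _; case: ltnP => // /(nth_default _) ->.
by rewrite mul0r.
Qed.

Lemma euler_poly_add p1 p2 b q k :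
  euler_poly (p1 + p2) b q k = euler_poly p1 b q k + euler_poly p2 b q k.
Proof.
rewrite !(@euler_poly_wide (maxn (size p1) (size p2))) ?leq_maxl ?leq_maxr ?size_polyD //.
by rewrite -big_split; apply: eq_bigr => i _; rewrite coefD mulrDl.
Qed.

Lemma euler_poly_scale a p b q k :
  euler_poly (a *: p) b q k = a * euler_poly p b q k.
Proof.
rewrite (@euler_poly_wide (size p)) ?size_scale_leq // mulr_sumr.
by apply: eq_bigr => i _; rewrite coefZ mulrA.
Qed.

Lemma euler_poly0 b q k : euler_poly 0 b q k = 0.
Proof. by rewrite /euler_poly size_poly0 big_ord0. Qed.

Lemma euler_poly_sum n (F : 'I_n -> {poly algC}) b q k :
  euler_poly (\sum_i F i) b q k = \sum_i euler_poly (F i) b q k.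
Proof.
apply: (big_morph (fun p => euler_poly p b q k)); last exact: euler_poly0.
by move=> p1 p2; apply: euler_poly_add.
Qed.

Lemma euler_poly_mulXsubC p b c q :
  euler_poly (p * ('X - c%:P)) b q = euler (b - c) (euler_poly p b q).
Proof.
apply/funext=> k; rewrite mulrBr euler_poly_add.
rewrite -mulrN -polyCN [p * _%:P]mulrC mul_polyC euler_poly_scale.
rewrite (@euler_poly_wide (size p).+1); last first.
  by have [->|p0] := eqVneq p 0; rewrite ?mul0r ?size_poly0 // size_mulX.
rewrite big_ord_recl coefMX /= mul0r add0r.
rewrite /euler mulrBl addrAC; congr (_ + _); last by rewrite mulNr.
rewrite /euler_poly !mulr_sumr -big_split /=; apply: eq_bigr => i _.
by rewrite coefMX /= mulrDr !mulrA ![p`_i * _]mulrC.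
Qed.

Lemma iter_ls_deriv i c a :
  iter i ls_deriv c a = euler_poly (ffact_poly algC i) (a + i%:R) (c (a + i%:R)).
Proof.
elim: i a => [|i IHi] a.
  apply/funext=> k; rewrite /ffact_poly big_ord0 addr0 /euler_poly size_poly1.
  by rewrite big_ord1 coef1 mul1r.
rewrite /ffact_poly big_ord_recr -/(ffact_poly _ i) euler_poly_mulXsubC /=.
have e : a + i.+1%:R = a + 1 + i%:R by rewrite -addrA -natr1 [1 + _]addrC.
rewrite e addrK -IHi; exact/funext.
Qed.

Lemma sum_coefXnM m N p (G : nat -> algC) : (m + size p <= N)%N ->
  \sum_(n < N) ('X^m * p)`_n * G n = \sum_(j < size p) p`_j * G (j + m)%N.
Proof.
move=> leN; rewrite -(big_mkord xpredT (fun n => ('X^m * p)`_n * G n)).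
rewrite (@big_cat_nat _ _ _ m) //=; last exact: leq_trans (leq_addr _ _) leN.
rewrite big_nat_cond big1 => [|n /andP[/andP[_ lt_nm] _]]; last first.
  by rewrite coefXnM lt_nm mul0r.
rewrite add0r -{1}[m]add0n big_addn big_mkord.
have le_s : (size p <= N - m)%N by lia.
rewrite (big_ord_widen _ (fun j => p`_j * G (j + m)%N) le_s) [RHS]big_mkcond /=.
apply: eq_bigr => n _; rewrite coefXnM ltnNge leq_addl /= addnK.
by case: ltnP => // /(nth_default _) ->; rewrite mul0r.
Qed.

(** The terms of B are sorted by the shift of exponents that they cause; for each
  shift, they add up to a polynomial in t d/dt. *)
Lemma ls_op_indicial (B : {poly {poly algC}}) c a k : exists N0, forall N,
  (N0 <= N)%N -> ls_op B c a k = \sum_(n < N)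
   euler_poly (indicial_coef B n) (a + ((size B).-1)%:R - n%:R)
     (c (a + ((size B).-1)%:R - n%:R)) k.
Proof.
set r := (size B).-1; exists (\sum_(i < size B) (r + size (B`_i)%R)%N) => N leN.
pose G i n := euler_poly (ffact_poly algC i) (a + r%:R - n%:R) (c (a + r%:R - n%:R)) k.
under [RHS]eq_bigr do rewrite /indicial_coef euler_poly_sum.
rewrite exchange_big /=; apply: eq_bigr => i _.
under [RHS]eq_bigr do rewrite euler_poly_scale.
have le_ir : (i <= r)%N by rewrite /r -ltnS prednK // (leq_trans _ (ltn_ord i)).
rewrite -/r (sum_coefXnM (G i)); last first.
  apply: leq_trans leN; rewrite (bigD1 i) //= ; apply: leq_trans (leq_addr _ _).
  by rewrite leq_add2r leq_subr.
apply: eq_bigr => j _; rewrite iter_ls_deriv /G.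
suff -> : a - j%:R + i%:R = a + r%:R - (j + (r - i))%:R by [].
by rewrite natrD natrB //; ring.
Qed.

Lemma euler_poly_zero p b q k : (forall k, q k = 0) -> euler_poly p b q k = 0.
Proof.
move=> q0; apply: big1 => i _; suff -> : iter i (euler b) q k = 0 by rewrite mulr0.
by move: (nat_of_ord i) k => n; elim: n => //= n IHn k; rewrite /euler !IHn !mulr0 addr0.
Qed.

(** The terms of smaller shift vanish by hypothesis on B, those of larger shift
  because they involve c below its leading exponent. *)
Lemma ls_op_leading (B : {poly {poly algC}}) n0 c a k :
    (forall m, (m < n0)%N -> indicial_coef B m = 0) ->
    (forall n l, (0 < n)%N -> c (a - n%:R) l = 0) ->
  ls_op B c (a + n0%:R - ((size B).-1)%:R) k =
  euler_poly (indicial_coef B n0) a (c a) k.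
Proof.
move=> B0 c0; set r := (size B).-1.
have [N0 NP] := ls_op_indicial B c (a + n0%:R - r%:R) k.
rewrite (NP (N0 + n0.+1)%N) ?leq_addr // -/r subrK.
have lt_n0 : (n0 < N0 + n0.+1)%N by lia.
rewrite (bigD1 (Ordinal lt_n0)) //= addrK big1 ?addr0 // => n nn0.
have [lt_n|lt_n|en] := ltngtP n n0; last 1 first.
- by case/eqP: nn0; apply: val_inj.
- by rewrite B0 // euler_poly0.
apply: euler_poly_zero => l; rewrite (_ : _ - n%:R = a - (n - n0)%:R).
  by rewrite c0 // subn_gt0.
by rewrite natrB ?(ltnW lt_n) //; ring.
Qed.

(** On t^b q(log t), the operator t d/dt is b plus the derivation of q, so p
  acts by Taylor's formula at b; only its first one or two terms reach the
  highest powers of log t. *)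
Lemma euler_poly_top p b q K : (forall k, (K < k)%N -> q k = 0) ->
  euler_poly p b q K = p.[b] * q K.
Proof.
move=> q0; rewrite horner_coef mulr_suml; apply: eq_bigr => i _.
rewrite -mulrA; congr (_ * _); move: (nat_of_ord i) => {}i.
suff [-> //] : iter i (euler b) q K = b ^+ i * q K /\
  forall k, (K < k)%N -> iter i (euler b) q k = 0.
elim: i => [|i [IH1 IH2]] /=; first by rewrite mul1r.
split=> [|k lt_k]; rewrite /euler.
  by rewrite IH1 IH2 // mulr0 addr0 exprS mulrA.
by rewrite !IH2 ?mulr0 ?addr0 // (ltn_trans lt_k).
Qed.

Lemma euler_poly_top2 p b q K : (forall k, (K.+1 < k)%N -> q k = 0) ->
  euler_poly p b q K = p.[b] * q K + p^`().[b] * (K.+1%:R * q K.+1).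
Proof.
move=> q0; rewrite horner_coef (@horner_coef_wide _ (size p)); last first.
  exact: leq_trans (size_poly _ _) (leq_pred _).
have -> : \sum_(i < size p) p^`()`_i * b ^+ i =
    \sum_(i < size p) p`_i * (b ^+ i.-1 *+ i).
  case: (size p) (nth_default 0 (leqnn (size p))) => [_|s ps]; first by rewrite !big_ord0.
  rewrite [RHS]big_ord_recl [LHS]big_ord_recr /= coef_deriv ps mul0rn mul0r addr0 mulr0n mulr0 add0r.
  by apply: eq_bigr => i _; rewrite coef_deriv mulrnAl mulrnAr.
rewrite !mulr_suml -big_split; apply: eq_bigr => i _ /=.
rewrite -!mulrA -mulrDr; congr (_ * _); move: (nat_of_ord i) => {}i.
suff [-> //] : [/\ iter i (euler b) q K =
    b ^+ i * q K + b ^+ i.-1 *+ i * (K.+1%:R * q K.+1),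
    iter i (euler b) q K.+1 = b ^+ i * q K.+1 &
  forall k, (K.+1 < k)%N -> iter i (euler b) q k = 0].
elim: i => [|i [IH0 IH1 IH2]] /=; first by rewrite !mul1r mulr0n mul0r addr0.
split=> [||k lt_k]; rewrite /euler.
- rewrite IH0 IH1; case: i {IH0 IH1 IH2} => [|i] /=.
    by rewrite !expr0 expr1 mulr1n mulr0n; ring.
  by rewrite -[_ *+ i.+1]mulr_natr -[_ *+ i.+2]mulr_natr -natr1 !exprS; ring.
- by rewrite IH1 IH2 // mulr0 addr0 exprS mulrA.
by rewrite !IH2 ?mulr0 ?addr0 // (ltn_trans lt_k).
Qed.

(** Below each exponent, only finitely many terms in its coset modulo Z.  Unlike
  [is_genseries], this is stable under linear combinations, and it suffices for
  leading terms to exist. *)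
Definition ls_fin (c : logseries) := forall a, exists b : nat,
  forall n k, (b <= n)%N || (b <= k)%N -> c (a - n%:R) k = 0.

Lemma ls_fin_leading c a k : ls_fin c -> c a k != 0 ->
  exists a0 K, [/\ c a0 K != 0, forall l, (K < l)%N -> c a0 l = 0 &
    forall n l, (0 < n)%N -> c (a0 - n%:R) l = 0].
Proof.
move=> cfin ca; have [b bP] := cfin a.
have bnd n l : c (a - n%:R) l != 0 -> (n <= b)%N /\ (l <= b)%N.
  by move=> nz; split; rewrite leqNgt; apply: contra nz => lt;
    rewrite bP // (ltnW lt) ?orbT.
have exn : exists n, `[< exists l, c (a - n%:R) l != 0 >].
  by exists 0%N; apply/asboolP; exists k; rewrite subr0.
have bn n : `[< exists l, c (a - n%:R) l != 0 >] -> (n <= b)%N.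
  by move=> /asboolP[l /bnd[]].
case: (ex_maxnP exn bn) => n /asboolP exl nmax.
have bl l : c (a - n%:R) l != 0 -> (l <= b)%N by case/bnd.
case: (ex_maxnP exl bl) => K cK Kmax; exists (a - n%:R), K; split=> //.
  by move=> l; apply: contraTeq => /Kmax; rewrite leqNgt.
move=> m l; apply: contraTeq => nz; rewrite -leqNgt -(leq_add2l n) addn0.
by apply: nmax; apply/asboolP; exists l; rewrite natrD opprD addrA.
Qed.

(** At a leading exponent a with highest term (log t)^K, the coefficient of
  (log t)^K in the equation gives P(a) = 0.  If K > 0, that of (log t)^(K-1)
  gives P'(a) = 0; if K = 0, the leading coefficient is one of those that
  vanish by hypothesis. *)
Theorem formal_solution_eq0 (B : {poly {poly algC}}) n0 c :
    let P := indicial_coef B n0 in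
    (forall m, (m < n0)%N -> indicial_coef B m = 0) ->
    ls_fin c -> (forall a k, ls_op B c a k = 0) ->
    (forall a, root P a -> c a 0%N = 0) ->
    (forall a, root P a -> P^`().[a] != 0) \/
      (forall a k, (0 < k)%N -> c a k = 0) ->
  forall a k, c a k = 0.
Proof.
move=> P B0 cfin cB cP simple a k; apply/eqP; apply: contraT => ca.
have [a0 [K [cK cgt clt]]] := ls_fin_leading cfin ca.
have /eqP := cB (a0 + n0%:R - ((size B).-1)%:R) K.
rewrite ls_op_leading // euler_poly_top // mulf_eq0 (negPf cK) orbF => Pa0.
case: K cK cgt Pa0 => [|K] cK cgt Pa0; first by rewrite cP ?eqxx in cK.
case: simple => [simple|nolog]; last by rewrite nolog ?eqxx in cK.
have /eqP := cB (a0 + n0%:R - ((size B).-1)%:R) K.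
rewrite ls_op_leading // euler_poly_top2 // -/P (eqP Pa0) mul0r add0r.
by rewrite !mulf_eq0 (negPf cK) (negPf (simple _ Pa0)) pnatr_eq0.
Qed.

End LogOperator.

(** * Expansions of rational functions at a point *)

Lemma derivation_scale (K : comNzRingType) (w : K) (D : K -> K) :
  derivation D -> derivation (fun x => w * D x).
Proof.
move=> derD; split=> x y; first by rewrite (derD_add derD) mulrDr.
by rewrite (derD_mul derD); ring.
Qed.

Lemma clear_op_apply (F L : fieldType) (phi : {rmorphism {poly F} -> L})
    (phi_inj : injective phi) D (M : {poly ratfun F}) x :
  op_apply phi D (clear_op M) x =
  phi (denom_op M) * op_apply (frac_lift phi_inj) D M x.
Proof.
rewrite (@op_apply_wide _ _ phi _ (size M)) ?rmorph0 ?size_poly //.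
rewrite mulr_sumr; apply: eq_bigr => i _.
by rewrite mulrA -!(frac_lift_tofrac phi_inj) -rmorphM /= clear_opE.
Qed.

Local Notation K := (laurent algC).
Local Notation u := (lu algC).
Local Notation const := (lconst algC).

(** The derivation d/dt for t = u^(N+1); recall dt = (N+1) u^N du. *)
Definition tder N (x : K) : K := (N.+1%:R * u ^+ N)^-1 * lder x.

Lemma tder_derivation N : derivation (tder N).
Proof. exact/derivation_scale/lder_derivation. Qed.

Lemma tder_const N a : tder N (const a) = 0.
Proof. by rewrite /tder lder_const mulr0. Qed.

Lemma natK_neq0 n : n.+1%:R != 0 :> K.
Proof. by rewrite -(rmorph_nat const) fmorph_eq0 pnatr_eq0. Qed.

Lemma tder_t N : tder N (u ^+ N.+1) = 1.
Proof.
rewrite /tder (derX (@lder_derivation algC)) lder_lu mulr1 -[X in _ * X]mulr_natl mulVf //.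
by rewrite mulf_neq0 ?natK_neq0 // luX_neq0.
Qed.

Lemma lcoef_tder N x i :
  lcoef (tder N x) i = (i + N.+1%:Z)%:~R / N.+1%:R * lcoef x (i + N.+1%:Z).
Proof.
have e : lder x = const N.+1%:R * (u ^+ N * tder N x).
  rewrite rmorph_nat /tder mulrA mulrA divff ?mul1r //.
  by rewrite mulf_neq0 ?natK_neq0 // luX_neq0.
have := lcoef_der x (i + N%:Z); rewrite e lcoef_const lcoef_luX addrK.
rewrite -addrA (_ : N%:Z + 1 = N.+1%:Z); last by lia.
by move=> e'; rewrite mulrAC -e' mulrC mulKf // pnatr_eq0.
Qed.

(** The Laurent series x in u = t^(1/(N+1)), as a series in t. *)
Definition lser N (x : K) : logseries := fun a k =>
  if (k == 0%N) && (a * N.+1%:R \is a Num.int)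
  then lcoef x (Num.floor (a * N.+1%:R)) else 0.

Lemma lserE N x (i : int) : lser N x (i%:~R / N.+1%:R) 0%N = lcoef x i.
Proof.
by rewrite /lser divfK ?pnatr_eq0 // intr_int intrKfloor.
Qed.

Lemma lser_cases N a : (exists i : int, a = i%:~R / N.+1%:R) \/
  (forall x k (n : int), lser N x (a + n%:~R) k = 0).
Proof.
have [/intrP[i ai]|ai] := boolP (a * N.+1%:R \is a Num.int).
  by left; exists i; rewrite -ai mulfK // pnatr_eq0.
right=> x k n; rewrite /lser mulrDl rpredDr; first by rewrite (negPf ai) andbF.
by rewrite rpredM ?intr_int ?natr_int.
Qed.

Lemma lser_log N x a k : (0 < k)%N -> lser N x a k = 0.
Proof. by case: k. Qed.

Lemma lserD N x y a k : lser N (x + y) a k = lser N x a k + lser N y a k.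
Proof. by rewrite /lser; case: ifP => _; rewrite ?addr0 // lcoefD. Qed.

Lemma lser_const N c x a k : lser N (const c * x) a k = c * lser N x a k.
Proof. by rewrite /lser; case: ifP => _; rewrite ?mulr0 // lcoef_const. Qed.

Lemma lser0 N a k : lser N 0 a k = 0.
Proof. by rewrite /lser; case: ifP => _ //; rewrite lcoef0. Qed.

Lemma lser_sum N (I : Type) (r : seq I) (P : pred I) (F : I -> K) a k :
  lser N (\sum_(i <- r | P i) F i) a k = \sum_(i <- r | P i) lser N (F i) a k.
Proof.
apply: (big_morph (fun x => lser N x a k)); last exact: lser0.
by move=> x y; apply: lserD.
Qed.

Lemma lser_shift N (i n : int) : 
  i%:~R / N.+1%:R + n%:~R = (i + n * N.+1%:Z)%:~R / N.+1%:R :> algC.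
Proof.
by rewrite rmorphD rmorphM /= mulrDl mulfK // pnatr_eq0.
Qed.

Lemma lser_tX N j x a k : lser N (u ^+ (N.+1 * j) * x) a k = lser N x (a - j%:R) k.
Proof.
case: k => [|k] //; have [[i ->]|a0] := lser_cases N a; last first.
  have := a0 x 0%N (- j%:Z); rewrite rmorphN /= => ->.
  by have := a0 (u ^+ (N.+1 * j) * x) 0%N 0; rewrite addr0.
rewrite lserE lcoef_luX.
have -> : i%:~R / N.+1%:R - j%:R = (i - (N.+1 * j)%N%:Z)%:~R / N.+1%:R :> algC.
  rewrite -[_ - j%:R]/(_ + - (j%:Z%:~R)) -rmorphN lser_shift /=.
  by congr (_%:~R / _); lia.
by rewrite lserE.
Qed.

Lemma lser_deriv N x : ls_deriv (lser N x) = lser N (tder N x).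
Proof.
apply/funext=> a; apply/funext=> -[|k]; last by rewrite /ls_deriv !lser_log // !mulr0 addr0.
rewrite /ls_deriv (lser_log _ _ _ (isT : (0 < 1)%N)) mulr0 addr0.
have [[i ->]|a0] := lser_cases N a; last first.
  have := a0 x 0%N 1; rewrite rmorph1 => ->; rewrite mulr0.
  by have := a0 (tder N x) 0%N 0; rewrite addr0.
rewrite lserE lcoef_tder.
have -> : i%:~R / N.+1%:R + 1 = (i + N.+1%:Z)%:~R / N.+1%:R :> algC.
  by rewrite -[1]/(1%:~R) lser_shift mul1r.
by rewrite lserE.
Qed.

Lemma iter_lser_deriv N i x : iter i ls_deriv (lser N x) = lser N (iter i (tder N) x).
Proof. by elim: i => //= i ->; rewrite lser_deriv. Qed.

Definition teval N : {rmorphism {poly algC} -> K} :=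
  horner_eval (u ^+ N.+1) \o map_poly const.

Lemma tevalE N p : teval N p = \sum_(j < size p) const p`_j * u ^+ (N.+1 * j).
Proof.
rewrite /= /horner_eval horner_coef size_map_poly; apply: eq_bigr => j _.
by rewrite coef_map exprM.
Qed.

Lemma lser_mulp N p x : ls_mulp p (lser N x) = lser N (teval N p * x).
Proof.
apply/funext=> a; apply/funext=> k; rewrite tevalE mulr_suml lser_sum.
by apply: eq_bigr => j _; rewrite -mulrA lser_const lser_tX.
Qed.

Lemma lser_op N (B : {poly {poly algC}}) x a k :
  ls_op B (lser N x) a k = lser N (op_apply (teval N) (tder N) B x) a k.
Proof.
rewrite /op_apply lser_sum; apply: eq_bigr => i _.
by rewrite iter_lser_deriv lser_mulp.
Qed.

Lemma ls_fin_lser N x : ls_fin (lser N x).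
Proof.
move=> a; have [m m0] := lcoef_bound x.
have [[i ->]|a0] := lser_cases N a; last first.
  by exists 0%N => n k _; have := a0 x k (- n%:Z); rewrite rmorphN.
exists (`|i| + m).+1 => n [|k] // /orP[|]; last by [].
move=> le_n; rewrite -[_ - n%:R]/(_ + - (n%:Z%:~R)) -rmorphN lser_shift /= lserE.
by apply: m0; nia.
Qed.

Definition zval (s : point) N : K :=
  if s is Some s0 then const s0 + u ^+ N.+1 else (u ^+ N.+1)^-1.

(** This is dt/dz = - t^2 times d(1/t)/dt, computed by the quotient rule. *)
Lemma inverse_rule (F : fieldType) (t : F) : t != 0 ->
  - t ^+ 2 * ((0 * t - 1 * 1) / t ^+ 2) = 1.
Proof.
by move=> t0; rewrite mul0r sub0r mul1r mulrA mulrNN mulr1 divff // expf_neq0.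
Qed.

(** The derivation d/dz; at infinity, dz = - dt / t^2. *)
Definition zder (s : point) N (x : K) : K :=
  (if s is Some _ then 1 else - (u ^+ N.+1) ^+ 2) * tder N x.

Lemma zder_derivation s N : derivation (zder s N).
Proof. exact/derivation_scale/tder_derivation. Qed.

Lemma zder_const s N a : zder s N (const a) = 0.
Proof. by rewrite /zder tder_const mulr0. Qed.

Lemma zder_z s N : zder s N (zval s N) = 1.
Proof.
have dt := tder_derivation N.
case: s => [s0|]; rewrite /zder /zval.
  by rewrite (derD_add dt) tder_const tder_t add0r mul1r.
have t0 := luX_neq0 algC N.+1.
have := der_div dt 1 t0; rewrite mul1r => ->; rewrite tder_t (der1 dt).
exact: inverse_rule.
Qed.

Definition ratc : {rmorphism rat -> K} := const \o ratr.

Definition zeval s N : {rmorphism {poly rat} -> K} :=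
  horner_eval (zval s N) \o map_poly ratc.

Lemma zeval_der s N p : zeval s N p^`() = zder s N (zeval s N p).
Proof.
have d0 : derivation (fun _ : rat => 0 : rat).
  by split=> x y; rewrite ?addr0 // mul0r mulr0 addr0.
have c0 a : ratc 0 = zder s N (ratc a) by rewrite rmorph0 zder_const.
rewrite /= /horner_eval (der_horner d0 (zder_derivation s N) c0) zder_z mulr1.
rewrite (_ : map_poly (fun=> 0) p = 0) ?rmorph0 ?horner0 ?add0r //.
by apply/polyP => i; rewrite coef_map_id0 // coef0.
Qed.

(** The local value of z is transcendental over the constants: its derivative is
  1, while the roots of a polynomial with constant coefficients are constant. *)
Lemma zeval_inj s N : injective (zeval s N).
Proof.
move=> p q /eqP; rewrite -subr_eq0 -rmorphB /=; set d := p - q => d0.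
apply/eqP; rewrite -subr_eq0 -/d; apply: contraT => dn0.
have [rs drs] := closed_field_poly_normal (map_poly ratr d : {poly algC}).
have : (map_poly const (map_poly ratr d)).[zval s N] == 0.
  by rewrite -map_poly_comp; apply: d0.
rewrite drs -mul_polyC rmorphM hornerM /= map_polyC hornerC.
rewrite mulf_eq0 fmorph_eq0 lead_coef_eq0 map_poly_eq0 (negPf dn0) /=.
rewrite map_prod_XsubC -(big_map const xpredT (fun r => 'X - r%:P)).
rewrite -[_ == 0]/(root _ _) root_prod_XsubC => /mapP[r _ ez].
by have := zder_z s N; rewrite ez zder_const => /esym/eqP; rewrite oner_eq0.
Qed.

Definition zembed s N : {rmorphism ratfun rat -> K} :=
  frac_lift (@zeval_inj s N).

Definition ratder : ratfun rat -> ratfun rat := frac_der (@deriv rat).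

Lemma ratder_derivation : derivation ratder.
Proof. exact/frac_derP/poly_derivation. Qed.

Lemma zembed_der s N x : zembed s N (ratder x) = zder s N (zembed s N x).
Proof.
apply: frac_lift_der; [exact: poly_derivation | exact: zder_derivation|].
exact: zeval_der.
Qed.

Lemma lsubst_zeval s N p : lsubst algC N (zeval s 0 p) = zeval s N p.
Proof.
rewrite /= /horner_eval -horner_map -map_poly_comp /=.
have -> : lsubst algC N (zval s 0) = zval s N.
  case: s => [s0|] /=; first by rewrite rmorphD lsubst_const expr1 lsubst_lu.
  by rewrite fmorphV expr1 lsubst_lu.
by congr (_.[_]); apply: eq_map_poly => a /=; rewrite lsubst_const.
Qed.

Lemma lsubst_zembed s N x : lsubst algC N (zembed s 0 x) = zembed s N x.
Proof.
by rewrite [LHS]fmorph_div !lsubst_zeval.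
Qed.

(** Puiseux's theorem is used for the embedding of Q(z) with ramification index 1;
  substituting u^(N+1) for u turns it into the one with index N+1. *)
Theorem puiseux_local s n (Q : {poly ratfun rat}) : Q \is monic ->
    size Q = n.+1 ->
  exists N rs, map_poly (zembed s N) Q = \prod_(r <- rs) ('X - r%:P).
Proof.
move=> Qm sQ; have [||N [rs Qrs]] := @puiseux_laurent algC n (map_poly (zembed s 0) Q).
- by rewrite map_monic.
- by rewrite size_map_poly.
exists N, rs; rewrite -Qrs -map_poly_comp.
by apply: eq_map_poly => x; exact/esym/lsubst_zembed.
Qed.

Local Notation tevalQ N := (teval N \o map_poly ratr).

Lemma teval_der N p : teval N p^`() = tder N (teval N p).
Proof.
have d0 : derivation (fun _ : algC => 0 : algC).
  by split=> x y; rewrite ?addr0 // mul0r mulr0 addr0.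
have c0 a : const 0 = tder N (const a) by rewrite rmorph0 tder_const.
rewrite /= /horner_eval (der_horner d0 (tder_derivation N) c0) tder_t mulr1.
rewrite (_ : map_poly (fun=> 0) p = 0) ?rmorph0 ?horner0 ?add0r //.
by apply/polyP => i; rewrite coef_map_id0 // coef0.
Qed.

Lemma tevalQ_der N (p : {poly rat}) :
  tevalQ N p^`() = tder N (tevalQ N p).
Proof. by rewrite -[RHS](teval_der N (map_poly ratr p)) deriv_map. Qed.

Lemma inf_deriv_apply N i x :
  op_apply (tevalQ N) (tder N) (inf_deriv rat i) x = iter i (zder None N) x.
Proof.
elim: i => [|i IHi].
  by rewrite /op_apply size_poly1 big_ord1 coef1 eqxx rmorph1 mul1r.
have X2 : tevalQ N (- 'X^2) = - (u ^+ N.+1) ^+ 2.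
  rewrite rmorphN rmorphXn; congr (- (_ ^+ 2)).
  by rewrite /= /horner_eval !map_polyX hornerX.
rewrite [LHS]op_applyCM op_applyD op_applyMX /= -IHi /zder.
congr (_ * _); first exact: X2.
rewrite (@op_apply_wide _ _ _ _ (size (inf_deriv rat i))) ?rmorph0 ?size_poly //.
rewrite -big_split /= /op_apply (der_sum (tder_derivation N)).
apply: eq_bigr => j _; rewrite (derD_mul (tder_derivation N)).
by rewrite coef_map_id0 ?deriv0 // -tevalQ_der.
Qed.

Lemma tevalQ_rev N E (p : {poly rat}) : ((size p).-1 <= E)%N ->
  tevalQ N (rev_poly E p) = (u ^+ N.+1) ^+ E * zeval None N p.
Proof.
move=> leE; have leE' : (size p <= E.+1)%N by move: leE; size_lia.
rewrite /= /horner_eval /rev_poly -map_poly_comp.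
rewrite (@horner_coef_wide _ E.+1); last first.
  by rewrite (leq_trans (size_poly _ _)) // size_poly.
rewrite (@horner_coef_wide _ E.+1); last by rewrite (leq_trans (size_poly _ _)).
rewrite (reindex_inj rev_ord_inj) mulr_sumr /=; apply: eq_bigr => j _.
have le_j : (j <= E)%N by rewrite -ltnS.
rewrite !coef_map /= coef_poly subSS ltnS leq_subr subKn // mulrCA.
congr (_ * _); rewrite exprVn; apply: (mulIf (expf_neq0 j (luX_neq0 algC N.+1))).
by rewrite -exprD subnK // divfK // expf_neq0 // luX_neq0.
Qed.

(** [local_op M s] is M, multiplied by its common denominator and, at infinity,
  by a power of t, and rewritten in terms of t and d/dt. *)
Lemma local_op_apply s N (M : {poly ratfun rat}) x :
  op_apply (zembed s N) (zder s N) M x = 0 ->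
  op_apply (teval N) (tder N) (local_op M s) x = 0.
Proof.
move=> Mx; have {Mx} : op_apply (zeval s N) (zder s N) (clear_op M) x = 0.
  by rewrite (clear_op_apply (@zeval_inj s N)) [X in _ * X]Mx mulr0.
case: s => [s0|] Mx; rewrite /local_op.
  rewrite -Mx (@op_apply_wide _ _ (teval N) _ (size (clear_op M))) ?rmorph0 ?size_poly //.
  apply: eq_bigr => i _; congr (_ * _).
    rewrite coef_map_id0 ?rmorph0 ?comp_poly0 //= /horner_eval map_comp_poly horner_comp.
    rewrite -map_poly_comp rmorphD /= map_polyX map_polyC hornerD hornerX hornerC addrC.
    by [].
  by apply: eq_iter => y; rewrite /zder mul1r.
rewrite (op_apply_map (teval N) _ (map_poly ratr)) /inf_op op_apply_sum.
set E := \max_(j < _) _; set S := op_apply _ _ _ _ in Mx *.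
transitivity ((u ^+ N.+1) ^+ E * S); last by rewrite Mx mulr0.
rewrite /S [op_apply (zeval _ _) _ _ _]/op_apply mulr_sumr.
apply: eq_bigr => i _; rewrite op_applyCM mulrA.
congr (_ * _); last exact: inf_deriv_apply.
apply: tevalQ_rev.
exact: (leq_bigmax (F := fun j : 'I__ => (size ((clear_op M)`_j)%R).-1)).
Qed.

(** * Orders and indicial polynomials of local operators *)

Lemma eq_size_support (R S : nzSemiRingType) (p : {poly R}) (q : {poly S}) :
  (forall i, (p`_i == 0) = (q`_i == 0)) -> size p = size q.
Proof.
move=> pq; apply/eqP; rewrite eqn_leq; apply/andP; split.
  by apply/leq_sizeP => i le_i; apply/eqP; rewrite pq nth_default.
by apply/leq_sizeP => i le_i; apply/eqP; rewrite -pq nth_default.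
Qed.

Lemma size_clear_op (F : fieldType) (M : {poly ratfun F}) :
  size (clear_op M) = size M.
Proof.
apply: eq_size_support => i.
by rewrite -tofrac_eq0 clear_opE mulf_eq0 tofrac_eq0 (negPf (denom_op_neq0 M)).
Qed.

Lemma size_inf_deriv (F : numFieldType) i : size (inf_deriv F i) = i.+1.
Proof.
elim: i => [|i IHi]; first by rewrite size_poly1.
rewrite /= size_Cmul; last by rewrite oppr_eq0 -size_poly_eq0 size_polyXn.
have B0 : inf_deriv F i != 0 by rewrite -size_poly_eq0 IHi.
rewrite addrC size_polyDl size_mulX // IHi // ltnS -[X in (_ <= X)%N]IHi.
exact: size_poly.
Qed.

Lemma rev_poly_eq0 (F : nzRingType) N (p : {poly F}) :
  ((size p).-1 <= N)%N -> p != 0 -> rev_poly N p != 0.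
Proof.
move=> leN p0; apply/eqP => /(congr1 (fun r : {poly F} => r`_(N - (size p).-1))).
rewrite coef0 coef_poly ltnS leq_subr subKn // -lead_coefE => /eqP.
by rewrite lead_coef_eq0 (negPf p0).
Qed.

Lemma size_inf_op (F : numFieldType) (A : {poly {poly F}}) :
  size (inf_op A) = size A.
Proof.
rewrite /inf_op; set N := \max_(j < _) _.
have leN i : (i < size A)%N -> ((size (A`_i)%R).-1 <= N)%N.
  move=> lt_i.
  exact: (leq_bigmax (F := fun j : 'I_(size A) => (size (A`_j)%R).-1) (Ordinal lt_i)).
have sT i : (size ((rev_poly N A`_i)%:P * inf_deriv F i)%R <= i.+1)%N.
  have [->|r0] := eqVneq (rev_poly N A`_i) 0; first by rewrite mul0r size_poly0.
  by rewrite size_Cmul // size_inf_deriv.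
case E: (size A) leN => [|r] leN; first by rewrite big_ord0 size_poly0.
rewrite big_ord_recr /= addrC.
have A0 : A`_r != 0.
  by rewrite -[r]/(r.+1.-1) -E -lead_coefE lead_coef_eq0 -size_poly_eq0 E.
have sr : size ((rev_poly N A`_r)%:P * inf_deriv F r) = r.+1.
  by rewrite size_Cmul ?size_inf_deriv // rev_poly_eq0 // leN.
rewrite size_polyDl sr // ltnS; apply: leq_trans (size_sum _ _ _) _.
by apply/bigmax_leqP => i _; apply: leq_trans (sT i) _.
Qed.

Lemma size_local_op (M : {poly ratfun rat}) s : size (local_op M s) = size M.
Proof.
rewrite -size_clear_op; case: s => [s0|]; rewrite /local_op.
  apply: size_map_inj_poly; last by rewrite rmorph0 comp_poly0.
  move=> a b /eqP; rewrite -subr_eq0 -rmorphB -rmorphB comp_poly2_eq0 ?size_XaddC //.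
  by rewrite map_poly_eq0 subr_eq0 => /eqP.
rewrite (size_map_inj_poly (map_poly_inj _)) ?rmorph0 //; exact: size_inf_op.
Qed.

Lemma size_ffact_poly (F : nzRingType) i : size (ffact_poly F i) = i.+1.
Proof.
by rewrite /ffact_poly size_prod_XsubC /index_enum -enumT size_enum_ord.
Qed.

Lemma monic_ffact_poly (F : nzRingType) i : ffact_poly F i \is monic.
Proof. exact: monic_prod_XsubC. Qed.

Lemma size_indicial_coef (F : nzRingType) (B : {poly {poly F}}) n :
  (size (indicial_coef B n) <= size B)%N.
Proof.
apply: leq_trans (size_sum _ _ _) _; apply/bigmax_leqP => i _.
by apply: leq_trans (size_scale_leq _ _) _; rewrite size_ffact_poly.
Qed.

(** The coefficient of X^r in the indicial coefficients comes from the leading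
  coefficient of the operator alone, so it is not always 0. *)
Lemma is_indicial_exists (M : {poly ratfun rat}) s : M != 0 ->
  exists P, is_indicial M s P.
Proof.
move=> M0; set B := local_op M s.
have sB : (0 < size B)%N by rewrite size_local_op size_poly_gt0.
set r := (size B).-1; have er : size B = r.+1 by rewrite /r prednK.
have Br0 : B`_r != 0 by rewrite -lead_coefE lead_coef_eq0 -size_poly_gt0.
have exn : exists n, indicial_coef B n != 0.
  exists (size B`_r).-1; apply/eqP => /(congr1 (fun p : {poly algC} => p`_r)).
  rewrite coef0 /indicial_coef coef_sum er big_ord_recr /= big1 ?add0r => [|i _].
    rewrite coefZ subnn expr0 mul1r -lead_coefE.
    have /monicP := monic_ffact_poly algC r.
    rewrite lead_coefE size_ffact_poly /= => ->; rewrite mulr1 => /eqP.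
    by rewrite lead_coef_eq0 (negPf Br0).
  by rewrite coefZ [(ffact_poly _ _)`_r]nth_default ?mulr0 // size_ffact_poly.
case: (ex_minnP exn) => n Pn nmin; exists (indicial_coef B n), n; split=> // m.
by rewrite ltnNge => /negP lt_m; apply: contra_notP lt_m => /eqP/nmin.
Qed.

Lemma rational_zeros_exists (P : {poly algC}) : P != 0 ->
  exists Z, rational_zeros P Z.
Proof.
move=> P0; have [rs Prs] := closed_field_poly_normal P.
exists (undup [seq getCrat x | x <- rs & x \in Crat]); split.
  exact: undup_uniq.
move=> q; have Pq x : root P x = (x \in rs).
  by rewrite Prs rootZ ?lead_coef_eq0 // root_prod_XsubC.
rewrite mem_undup Pq; apply/mapP/idP => [[x]|qr].
  by rewrite mem_filter => /andP[xQ xr] ->; rewrite getCratK.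
by exists (ratr q); rewrite ?mem_filter ?qr ?Crat_rat // ratCK.
Qed.

Lemma rational_zeros_size (P : {poly algC}) Z : P != 0 -> rational_zeros P Z ->
  (size Z <= (size P).-1)%N.
Proof.
move=> P0 [Zu ZP].
have : (size (map (ratr : rat -> algC) Z) < size P)%N.
  apply: max_poly_roots => //.
    by apply/allP => _ /mapP[q qZ ->]; rewrite -ZP.
  by rewrite map_inj_uniq //; apply: fmorph_inj.
by rewrite size_map; size_lia.
Qed.

(** As many zeros as the degree: there are no other ones, and no multiple one. *)
Lemma rational_zeros_simple (P : {poly algC}) Z : P != 0 -> rational_zeros P Z ->
    ((size P).-1 <= size Z)%N ->
  forall a, root P a -> (exists2 q, q \in Z & a = ratr q) /\ P^`().[a] != 0.
Proof.
move=> P0 [Zu ZP] leZ a Pa.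
have leZ' := rational_zeros_size P0 (conj Zu ZP).
pose Z' := map (ratr : rat -> algC) Z.
have Z'u : uniq Z' by rewrite map_inj_uniq //; apply: fmorph_inj.
have eP : P = lead_coef P *: \prod_(z <- Z') ('X - z%:P).
  apply: all_roots_prod_XsubC; rewrite ?uniq_rootsE //.
    rewrite size_map; move: P0 leZ leZ'; rewrite -size_poly_gt0; size_lia.
  by apply/allP => _ /mapP[q qZ ->]; rewrite -ZP.
have := Pa; rewrite {1}eP rootZ ?lead_coef_eq0 // root_prod_XsubC => aZ.
split; first by have /mapP[q qZ ->] := aZ; exists q.
have : separable_poly (\prod_(z <- Z') ('X - z%:P)) by rewrite separable_prod_XsubC.
rewrite eP derivZ hornerZ mulf_eq0 lead_coef_eq0 (negPf P0) /= unlock.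
by move/coprimep_root => /(_ a); apply; rewrite root_prod_XsubC.
Qed.

(** * Linear combinations of local solutions *)

Section LinearCombination.
Variables (B : {poly {poly algC}}) (n : nat).
Implicit Types (c : logseries) (d : 'I_n -> logseries) (x : 'I_n -> algC).

Definition ls_comb c x d : logseries :=
  fun a k => c a k - \sum_(i < n) x i * d i a k.

Lemma iter_deriv_comb j c x d : iter j ls_deriv (ls_comb c x d) =
  ls_comb (iter j ls_deriv c) x (fun i => iter j ls_deriv (d i)).
Proof.
elim: j => //= j ->; apply/funext=> a; apply/funext=> k.
rewrite /ls_deriv /ls_comb !mulrBr addrACA -opprD !mulr_sumr -big_split.
by congr (_ - _); apply: eq_bigr => i _ /=; ring.
Qed.

Lemma ls_op_comb c x d a k : ls_op B (ls_comb c x d) a k =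
  ls_op B c a k - \sum_(i < n) x i * ls_op B (d i) a k.
Proof.
rewrite /ls_op; under [X in _ - X]eq_bigr do rewrite mulr_sumr.
rewrite exchange_big -sumrB; apply: eq_bigr => j _; rewrite iter_deriv_comb.
rewrite /ls_mulp; under [X in _ - X]eq_bigr do rewrite mulr_sumr.
rewrite exchange_big -sumrB; apply: eq_bigr => l _.
rewrite /ls_comb mulrBr mulr_sumr; congr (_ - _).
by apply: eq_bigr => i _; rewrite mulrCA.
Qed.

Lemma ls_fin_comb c x d : ls_fin c -> (forall i, ls_fin (d i)) ->
  ls_fin (ls_comb c x d).
Proof.
move=> cf df a; have [b cb] := cf a.
have /choice[e de] : forall i, exists e, forall l k,
    (e <= l)%N || (e <= k)%N -> d i (a - l%:R) k = 0 by move=> i; apply: df.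
exists (b + \sum_i e i)%N => l k lk; rewrite /ls_comb cb ?sub0r.
  rewrite big1 ?oppr0 // => i _; rewrite de ?mulr0 //.
  have le_e : (e i <= b + \sum_i e i)%N.
    by rewrite (bigD1 i) //= addnCA leq_addr.
  by case/orP: lk => /(leq_trans le_e) ->; rewrite ?orbT.
by case/orP: lk => /(leq_trans (leq_addr _ _)) ->; rewrite ?orbT.
Qed.

End LinearCombination.

Lemma ls_fin_genseries c : is_genseries c -> ls_fin c.
Proof.
move=> [rho [m cP]] a; exists (Num.truncn `|a - rho| + m).+1 => n k.
apply: contraTeq => /cP[[l e] le_k]; rewrite negb_or -!ltnNge !ltnS.
rewrite (leq_trans le_k (leq_addl _ _)) andbT.
have -> : a - rho = (n + l)%:R by rewrite natrD -[a](subrK n%:R) e; ring.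
by rewrite normr_nat natrK -addnA leq_addr.
Qed.

Lemma formal_solution_span (B : {poly {poly algC}}) n0 n c x
    (d : 'I_n -> logseries) :
    let P := indicial_coef B n0 in
    (forall m, (m < n0)%N -> indicial_coef B m = 0) ->
    ls_fin c -> (forall i, ls_fin (d i)) ->
    (forall a k, ls_op B c a k = 0) -> (forall i a k, ls_op B (d i) a k = 0) ->
    (forall a, root P a -> c a 0%N = \sum_i x i * d i a 0%N) ->
    (forall a, root P a -> P^`().[a] != 0) \/
      (forall a k, (0 < k)%N -> c a k = 0 /\ forall i, d i a k = 0) ->
  forall a k, c a k = \sum_i x i * d i a k.
Proof.
move=> P B0 cf df cB dB cP simple a k; apply/eqP; rewrite -subr_eq0; apply/eqP.
apply: (@formal_solution_eq0 B n0 (ls_comb c x d)) => //.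
- exact: ls_fin_comb.
- by move=> b l; rewrite ls_op_comb cB big1 ?subr0 // => i _; rewrite dB mulr0.
- by move=> b /cP; rewrite /ls_comb => ->; rewrite subrr.
case: simple => [|nolog]; [by left | right=> b l l0].
have [c0 d0] := nolog b l l0.
by rewrite /ls_comb c0 big1 ?subr0 // => i _; rewrite d0 mulr0.
Qed.

(** * Minimal operators and minimal polynomials of power series *)

Local Notation K0 := {fraction (fps rat)}.

Definition poly_fracfps : {rmorphism {poly rat} -> K0} :=
  @FracField.tofrac _ \o @fps_of rat.

Lemma poly_fracfps_inj : injective poly_fracfps.
Proof. by move=> p q /eqP; rewrite /= tofrac_eq => /eqP/fps_of_inj. Qed.

Definition rat_fracfps : {rmorphism ratfun rat -> K0} :=
  frac_lift poly_fracfps_inj.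

Definition fracfps_der : K0 -> K0 := frac_der (@fps_deriv rat).

Lemma fracfps_derivation : derivation fracfps_der.
Proof. exact/frac_derP/fps_derivation. Qed.

Lemma rat_fracfps_der x : rat_fracfps (ratder x) = fracfps_der (rat_fracfps x).
Proof.
apply: frac_lift_der; [exact: poly_derivation | exact: fracfps_derivation|].
move=> a; rewrite /= -fps_deriv_of; apply/esym/frac_der_tofrac/fps_derivation.
Qed.

Definition fracfps (f : series rat) : K0 := (f : fps rat)%:F.

Lemma op_seriesE (A : {poly {poly rat}}) f :
  (forall n, op_series A f n = 0) <->
  op_apply poly_fracfps fracfps_der A (fracfps f) = 0.
Proof.
have iterE i : iter i fracfps_der (fracfps f) = fracfps (iter i (@ser_deriv rat) f).
  by elim: i => //= i ->; apply/frac_der_tofrac/fps_derivation.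
have -> : op_apply poly_fracfps fracfps_der A (fracfps f) = fracfps (op_series A f).
  rewrite /op_apply (_ : op_series A f =
    \sum_(i < size A) fps_of A`_i * (iter i (@ser_deriv rat) f : fps rat)).
    rewrite /fracfps rmorph_sum; apply: eq_bigr => i _.
    by rewrite iterE rmorphM.
  by apply/funext=> n; rewrite fps_sumE.
split=> [Af|/eqP]; first by apply/eqP; rewrite tofrac_eq0; apply/eqP/funext.
by rewrite tofrac_eq0 => /eqP/funeqP.
Qed.

Lemma annihilatesE (M : {poly ratfun rat}) f : annihilates M f <->
  op_apply rat_fracfps fracfps_der M (fracfps f) = 0.
Proof.
rewrite /annihilates op_seriesE (clear_op_apply poly_fracfps_inj).
split=> [/eqP|->]; last by rewrite mulr0.
rewrite mulf_eq0 => /orP[|/eqP//]; rewrite -(rmorph0 poly_fracfps).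
by rewrite (inj_eq poly_fracfps_inj) (negPf (denom_op_neq0 M)).
Qed.

Lemma algebraic_root f : algebraic_series f ->
  exists2 P : {poly ratfun rat}, P != 0 & root (map_poly rat_fracfps P) (fracfps f).
Proof.
move=> [P P0 Pf]; exists (map_poly (@FracField.tofrac _) P).
  rewrite -size_poly_eq0 (size_map_inj_poly (@tofrac_inj _)) ?rmorph0 //.
  by rewrite size_poly_eq0.
rewrite -map_poly_comp /root horner_coef.
have -> : map_poly (rat_fracfps \o @FracField.tofrac _) P = map_poly poly_fracfps P.
  by apply: eq_map_poly => p; apply: frac_lift_tofrac.
rewrite (size_map_inj_poly poly_fracfps_inj) ?rmorph0 //.
have eP : \sum_(i < size P) fps_of P`_i * (f : fps rat) ^+ i = 0.
  apply/funext=> n; rewrite fps_sumE -[RHS](Pf n); apply: eq_bigr => i _.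
  by rewrite fpsXnE.
apply/eqP; transitivity (fracfps (\sum_(i < size P) fps_of P`_i * (f : fps rat) ^+ i)).
  rewrite [RHS]rmorph_sum; apply: eq_bigr => i _.
  by rewrite coef_map [RHS]rmorphM rmorphXn.
by rewrite eP /fracfps tofrac0.
Qed.

Lemma min_size_exists (R : nzSemiRingType) (S : {poly R} -> Prop) :
  (exists2 P, P != 0 & S P) ->
  exists Q, [/\ Q != 0, S Q & forall P, P != 0 -> S P -> (size Q <= size P)%N].
Proof.
move=> [P0 P00 SP0].
have exn : exists n, `[< exists P, [/\ P != 0, S P & size P = n] >].
  by exists (size P0); apply/asboolP; exists P0.
case: (ex_minnP exn) => n /asboolP[Q [Q0 SQ sQ]] nmin; exists Q; split=> // P Pn0 SP.
by rewrite sQ; apply: nmin; apply/asboolP; exists P.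
Qed.

Lemma monic_min_size_exists (F : fieldType) (S : {poly F} -> Prop) :
  (forall a P, S P -> S (a%:P * P)) -> (exists2 P, P != 0 & S P) ->
  exists Q, [/\ Q \is monic, S Q & forall P, P != 0 -> S P -> (size Q <= size P)%N].
Proof.
move=> SZ /min_size_exists[Q [Q0 SQ Qmin]]; exists ((lead_coef Q)^-1%:P * Q).
have l0 : (lead_coef Q)^-1 != 0 by rewrite invr_eq0 lead_coef_eq0.
split; [|exact: SZ|by rewrite size_Cmul].
by rewrite monicE lead_coefM lead_coefC mulVf // lead_coef_eq0.
Qed.

Lemma min_poly_exists f : algebraic_series f -> exists Q : {poly ratfun rat},
  [/\ Q \is monic, root (map_poly rat_fracfps Q) (fracfps f) &
   forall P, P != 0 -> root (map_poly rat_fracfps P) (fracfps f) ->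
     (size Q <= size P)%N].
Proof.
move/algebraic_root; apply: monic_min_size_exists => a P.
by rewrite rmorphM rootM orbC => ->.
Qed.

Lemma min_op_exists (L : {poly {poly rat}}) f :
  L != 0 -> (forall n, op_series L f n = 0) -> exists M, is_min_op M f.
Proof.
move=> L0 Lf; apply: (@monic_min_size_exists _ (fun M => annihilates M f)).
  by move=> a M /annihilatesE Mf; apply/annihilatesE; rewrite op_applyCM Mf mulr0.
exists (map_poly (@FracField.tofrac _) L).
  rewrite -size_poly_eq0 (size_map_inj_poly (@tofrac_inj _)) ?rmorph0 //.
  by rewrite size_poly_eq0.
apply/annihilatesE; rewrite op_apply_map; move/op_seriesE: Lf => <-.
apply: eq_bigr => i _; congr (_ * _); exact: frac_lift_tofrac.
Qed.

(** * Local solutions of the minimal operator of an algebraic series *)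

Section AlgebraicLocal.
Variables (f : series rat) (M : {poly ratfun rat}) (s : point).
Hypotheses (f_alg : algebraic_series f) (M_min : is_min_op M f).

Theorem puiseux_solutions : exists N (rs : seq (laurent algC)),
  [/\ forall c, c \in rs -> op_apply (zembed s N) (zder s N) M c = 0 &
   \rank (\matrix_(i < (size M).-1, j < size rs) iter i (zder s N) rs`_j)
     = (size M).-1].
Proof.
have [Q [Qm Qf Qmin]] := min_poly_exists f_alg.
have [Mm /annihilatesE Mf Mmin] := M_min.
have sQ : size Q = (size Q).-1.+1.
  by have := monic_neq0 Qm; rewrite -size_poly_gt0; size_lia.
have sM : size M = (size M).-1.+1.
  by have := monic_neq0 Mm; rewrite -size_poly_gt0; size_lia.
have [N [rs Qrs]] := puiseux_local s Qm sQ.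
have char0 n : n.+1%:R != 0 :> ratfun rat.
  rewrite -(rmorph_nat (@FracField.tofrac _ \o polyC)) /= tofrac_eq0 polyC_eq0.
  by rewrite pnatr_eq0.
exists N, rs; split.
  move=> c crs; apply: (conjugate_solution ratder_derivation fracfps_derivation
    rat_fracfps_der char0 Qm Qf Qmin (zder_derivation s N) (zembed_der s N) Mf).
  by rewrite Qrs root_prod_XsubC.
apply: (conjugate_wronskian_rank ratder_derivation fracfps_derivation
    rat_fracfps_der char0 Qm Qf Qmin (zder_derivation s N) (zembed_der s N)) => //.
by move=> M' M'0 /annihilatesE M'f; rewrite -sM; apply: Mmin.
Qed.

(** The coefficients of the Puiseux solutions at the rational zeros of P form a
  matrix E.  A relation between its rows is a combination of the solutions that
  vanishes at all the exponents, hence is 0, so E has rank at least r; since it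
  has at most deg P <= r columns, its columns are independent, and any formal
  solution has the same coefficients at the exponents as some combination of the
  Puiseux solutions. *)
Theorem algebraic_local P Z : is_indicial M s P -> rational_zeros P Z ->
  [/\ (size P).-1 = (size M).-1, size Z = (size M).-1 &
   forall c, formal_solution M s c -> forall a k, (0 < k)%N -> c a k = 0].
Proof.
move=> [n0 [eP P0 Pmin]] PZ; have [N [rs [rsM rsW]]] := puiseux_solutions.
set r := (size M).-1 in rsW *; set n := size rs in rsW *.
pose B := local_op M s.
have lser_sol x : op_apply (zembed s N) (zder s N) M x = 0 ->
    forall a k, ls_op B (lser N x) a k = 0.
  by move=> /local_op_apply Mx a k; rewrite lser_op Mx lser0.
have P_root : forall a, root P a -> a \in Crat ->
    exists l : 'I_(size Z), a = ratr Z`_l.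
  move=> _ /[swap] /CratP[q ->]; rewrite -(PZ.2 q) => qZ.
  by exists (Ordinal (introT idP (etrans (index_mem q Z) qZ))); rewrite /= nth_index.
pose E := \matrix_(j < n, l < size Z) lser N rs`_j (ratr Z`_l) 0%N.
have rankE : (r <= \rank E)%N.
  pose V := kermx E; pose W := \matrix_(i < r, j < n) iter i (zder s N) rs`_j.
  have VW : map_mx (lconst algC) V *m W^T = 0.
    apply/matrixP => i i'; rewrite !mxE.
    (* Row i of V is a relation between the rows of E. *)
    pose x := \sum_(j < n) lconst algC (V i j) * rs`_j.
    have x0 : x = 0.
      apply: lcoef_inj => l; rewrite -(lserE N).
      apply: (@formal_solution_eq0 B n0 (lser N x)).
      - exact: Pmin.
      - exact: ls_fin_lser.
      - apply: lser_sol; rewrite (op_apply_comb _ _ _ (zder_derivation s N)).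
          by apply: big1 => j _; rewrite rsM ?mulr0 // mem_nth.
        by move=> j; apply: zder_const.
      - rewrite -eP => a Pa.
        have [[j aj]|a0] := lser_cases N a; last by have := a0 x 0%N 0; rewrite addr0.
        have [|l' ->] := P_root a Pa.
          by rewrite aj rpred_div ?rpred_int ?rpred_nat.
        rewrite lser_sum; have := congr1 (fun A : 'M_(_, _) => A i l') (mulmx_ker E).
        rewrite !mxE => e; rewrite -[RHS]e; apply: eq_bigr => t _.
        by rewrite lser_const !mxE.
      - by right=> a [].
    transitivity (iter i' (zder s N) x); last first.
      rewrite x0; elim: (nat_of_ord i') => //= m ->.
      by rewrite (der0 (zder_derivation s N)).
    rewrite (der_iter_sum (zder_derivation s N)); apply: eq_bigr => j _.
    rewrite (der_iter_const (zder_derivation s N)) ?zder_const //.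
    by rewrite !mxE.
  have := mulmx0_rank_max VW; rewrite mxrank_map mxrank_tr rsW mxrank_ker.
  by move=> le_n; rewrite -(leq_add2l (n - \rank E)) subnK ?rank_leq_row.
have leZ := rational_zeros_size P0 PZ.
have leP : (size P <= size M)%N by rewrite eP -(size_local_op M s) size_indicial_coef.
have leE := rank_leq_col E.
have [sP sZ] : (size P).-1 = r /\ size Z = r.
  by move: leE rankE leZ leP; rewrite /r; size_lia.
split=> // c [cgen cB] a k k0.
have Psimple : forall a, root P a -> (exists2 q, q \in Z & a = ratr q) /\ P^`().[a] != 0.
  by apply: rational_zeros_simple PZ _; rewrite // sP sZ.
have /submxP[u eu] : ((\row_l c (ratr Z`_l) 0%N) <= E)%MS.
  by apply: submx_full; rewrite /row_full eqn_leq leE /=; apply: leq_trans rankE; rewrite sZ.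
rewrite (@formal_solution_span B n0 n c (u 0) (fun j => lser N rs`_j)).
- by apply: big1 => j _; rewrite lser_log ?mulr0.
- exact: Pmin.
- exact: ls_fin_genseries.
- by move=> j; apply: ls_fin_lser.
- exact: cB.
- by move=> j; apply/lser_sol/rsM/mem_nth.
- rewrite -eP => b /Psimple[[q qZ ->] _].
  have lt_q : (index q Z < size Z)%N by rewrite index_mem.
  have := congr1 (fun A : 'M_(_, _) => A 0 (Ordinal lt_q)) eu.
  rewrite !mxE /= nth_index // => ->; apply: eq_bigr => j _.
  by rewrite !mxE /= nth_index.
- by left; rewrite -eP => b /Psimple[].
Qed.

End AlgebraicLocal.

(** * Termination *)

Section FormalBasis.
Variables (M : {poly ratfun rat}) (s : point) (P : {poly algC}) (Z : seq rat).
Hypotheses (MP : is_indicial M s P) (PZ : rational_zeros P Z)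
  (le_Z : ((size P).-1 <= size Z)%N).

Let ev (c : logseries) : 'rV[algC]_(size Z) := \row_l c (ratr Z`_l) 0%N.

(** A family of solutions whose coefficients at the exponents are independent,
  maximal for this property, is a basis. *)
Lemma formal_basis_exists : exists d (B : 'I_d -> logseries), is_formal_basis M s B.
Proof.
have [n0 [eP P0 Pmin]] := MP; pose L := local_op M s.
have Psimple := rational_zeros_simple P0 PZ le_Z.
have span n c (x : 'I_n -> algC) (d : 'I_n -> logseries) :
    formal_solution M s c -> (forall i, formal_solution M s (d i)) ->
    ev c = \sum_i x i *: ev (d i) -> forall a k, c a k = \sum_i x i * d i a k.
  move=> [cgen cL] dsol e.
  apply: (@formal_solution_span L n0) => //.
  - exact: ls_fin_genseries.
  - by move=> i; apply: ls_fin_genseries; case: (dsol i).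
  - by move=> i; case: (dsol i).
  - rewrite -eP => b /Psimple[[q qZ ->] _].
    have lt_q : (index q Z < size Z)%N by rewrite index_mem.
    have := congr1 (fun A : 'M_(_, _) => A 0 (Ordinal lt_q)) e.
    rewrite summxE !mxE /= nth_index // => ->; apply: eq_bigr => j _.
    by rewrite !mxE /= nth_index.
  - by left; rewrite -eP => b /Psimple[].
pose evs d (cs : nat -> logseries) := \matrix_(i < d) ev (cs i).
pose free_sols d := exists cs : nat -> logseries,
  (forall i, (i < d)%N -> formal_solution M s (cs i)) /\ \rank (evs d cs) = d.
have ex_free : exists d, `[< free_sols d >].
  exists 0%N; apply/asboolP; exists (fun _ _ _ => 0); split=> //.
  by apply/eqP; rewrite -leqn0 rank_leq_row.
have free_bound d : `[< free_sols d >] -> (d <= size Z)%N.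
  by move=> /asboolP[cs [_ <-]]; apply: rank_leq_col.
case: (ex_maxnP ex_free free_bound) => d /asboolP[cs [cs_sol cs_free]] d_max.
exists d, (fun i => cs i); split=> [i|u u0|c c_sol]; first exact: cs_sol.
  have /rowP u0' : \row_i u i = 0.
    have ev_free : row_free (evs d cs) by rewrite /row_free cs_free.
    apply/eqP; rewrite -(mulmx_free_eq0 _ ev_free); apply/eqP/rowP => l.
    rewrite !mxE -[RHS](u0 (ratr Z`_l) 0%N).
    by apply: eq_bigr => i _; rewrite !mxE.
  by move=> i; have := u0' i; rewrite !mxE.
suff /submxP[u eu] : (ev c <= evs d cs)%MS.
  exists (u 0); apply: span => // [i|]; first exact: cs_sol.
  rewrite eu mulmx_sum_row; apply: eq_bigr => i _.
  by congr (_ *: _); apply/rowP => l; rewrite !mxE.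
apply: contraT => c_new; pose cs' i := if i == d then c else cs i.
have cs'_lt (i : 'I_d) : cs' i = cs i by rewrite /cs' ltn_eqF.
have : (evs d cs + ev c <= evs d.+1 cs')%MS.
  rewrite addsmx_sub; apply/andP; split.
    apply/row_subP => i.
    suff -> : row i (evs d cs) = row (widen_ord (leqnSn d) i) (evs d.+1 cs').
      exact: row_sub.
    by apply/rowP => l; rewrite !mxE /= cs'_lt.
  suff -> : ev c = row ord_max (evs d.+1 cs') by apply: row_sub.
  by apply/rowP => l; rewrite !mxE /cs' /= eqxx.
move/mxrankS => le_rank.
have lt_rank : (d < \rank (evs d cs + ev c)%MS)%N.
  rewrite -{1}cs_free; apply: rank_ltmx; rewrite ltmxE addsmxSl /=.
  by apply: contra c_new; apply: submx_trans; apply: addsmxSr.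
suff /asboolP/d_max : free_sols d.+1 by rewrite ltnn.
exists cs'; split=> [i|].
  rewrite ltnS leq_eqVlt /cs' => /predU1P[->|lt_i]; first by rewrite eqxx.
  by rewrite ltn_eqF //; apply: cs_sol.
apply/eqP; rewrite eqn_leq rank_leq_row; exact: leq_trans lt_rank le_rank.
Qed.

End FormalBasis.

Lemma leading_exponent_exists c a k : is_genseries c -> c a k != 0 ->
  exists rho, leading_exponent c rho.
Proof.
move=> [rho [K cP]] ca; have [[n0 en0] _] := cP a k ca.
have exn : exists n, `[< exists l, c (rho + n%:R) l != 0 >].
  by exists n0; apply/asboolP; exists k; rewrite -en0.
case: (ex_minnP exn) => n /asboolP cn nmin; exists (rho + n%:R); split=> //.
move=> b l cb; have [[m em] _] := cP b l cb; exists (m - n)%N.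
rewrite -addrA -natrD subnKC //; apply: nmin; apply/asboolP.
by exists l; rewrite -em.
Qed.

Lemma truncated_basis_exists M s d (B : 'I_d -> logseries) N :
  is_formal_basis M s B -> exists Bt : 'I_d -> logseries, is_truncated_basis M s N Bt.
Proof.
move=> Bb; have [B_sol B_free B_span] := Bb.
have /choice[rho rhoP] : forall i, exists rho, leading_exponent (B i) rho.
  move=> i; have [a [k nz]] : exists a k, B i a k != 0.
    apply: contrapT => Bi0.
    suff /B_free/(_ i)/eqP : forall a k, \sum_j (j == i)%:R * B j a k = 0.
      by rewrite eqxx oner_eq0.
    move=> a k; rewrite (bigD1 i) //= big1 => [|j /negPf->]; last by rewrite mul0r.
    rewrite eqxx mul1r addr0; apply/eqP; apply: contraT => nz.
    by case: Bi0; exists a, k.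
  by have [Bgen _] := B_sol i; apply: leading_exponent_exists Bgen nz.
exists (fun i a k => if [exists n : 'I_N.+1, a == rho i + n%:R] then B i a k else 0).
by exists B => // i; exists (rho i).
Qed.

Lemma inspect_exists M s : M != 0 -> exists b, inspect M s b.
Proof.
move=> M0; have [P MP] := is_indicial_exists s M0.
have [_ [_ P0 _]] := MP; have [Z PZ] := rational_zeros_exists P0.
have [irr|reg] := boolP ((size P).-1 < (size M).-1)%N.
  by exists true; apply: inspect_irregular MP irr.
have [lt_Z|le_Z] := boolP (size Z < (size P).-1)%N.
  by exists true; apply: inspect_zeros MP reg PZ lt_Z.
have [gap0|gap] := eqVneq (positive_gaps Z) [::].
  by exists false; apply: inspect_no_gap MP reg PZ le_Z gap0.
have [|d [B Bb]] := formal_basis_exists MP PZ; first by rewrite leqNgt.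
have [Bt BtP] := truncated_basis_exists (\max_(n <- positive_gaps Z) n) Bb.
have [logs|nologs] := pselect (exists i, contains_log (Bt i)).
  by exists true; apply: inspect_log MP reg PZ le_Z (elimN eqP gap) BtP logs.
by exists false; apply: inspect_no_log MP reg PZ le_Z (elimN eqP gap) BtP nologs.
Qed.

Lemma inspect_all_exists M S : M != 0 -> exists o, inspect_all M S o.
Proof.
move=> M0; elim: S => [|s S [o IHS]]; first by exists FAIL; apply: inspect_all_nil.
have [[] sb] := inspect_exists s M0; first by exists T; apply: inspect_all_stop.
by exists o; apply: inspect_all_next.
Qed.

(** The finite singularities are among the zeros of the leading coefficient. *)
Lemma singularities_exist M : M != 0 ->
  exists2 S : seq point, uniq S & forall s, s \in S <-> singularity M s.
Proof.
move=> M0; pose l := map_poly (ratr : rat -> algC) (lead_coef (clear_op M)).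
have l0 : l != 0.
  by rewrite map_poly_eq0 lead_coef_eq0 -size_poly_eq0 size_clear_op size_poly_eq0.
have [rs lrs] := closed_field_poly_normal l.
pose S := None :: map Some rs.
exists (undup [seq s <- S | `[< singularity M s >]]); first exact: undup_uniq.
move=> s; rewrite mem_undup mem_filter; split=> [/andP[/asboolP] //|sing].
rewrite (asboolT sing) /=; case: s sing => [s0|] sing; last exact: mem_head.
rewrite inE /= mem_map; last by move=> ? ? [].
apply: contraT => s0rs; have [i] := sing; case.
exists (local_op M (Some s0))`_i, (lead_coef (local_op M (Some s0))); split=> //.
have -> : lead_coef (local_op M (Some s0)) = l \Po ('X + s0%:P).
  rewrite lead_coefE size_local_op -size_clear_op coef_map_id0 ?rmorph0 ?comp_poly0 //.
by rewrite horner_comp !hornerE lrs hornerZ mulf_neq0 ?lead_coef_eq0 //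
  -[_ != 0]/(~~ root _ _) root_prod_XsubC.
Qed.

(** * Soundness *)

Lemma inspect_true_transcendental f M s :
  is_min_op M f -> inspect M s true -> transcendental f.
Proof.
move=> Mmin run f_alg; move eb: true run => b run.
case: run eb => // [P MP|P Z MP _ PZ|P Z d Bt MP _ PZ _ _].
- have [_ [_ P0 _]] := MP; have [Z PZ] := rational_zeros_exists P0.
  by have [-> _ _] := algebraic_local f_alg Mmin MP PZ; rewrite ltnn.
- by have [-> -> _] := algebraic_local f_alg Mmin MP PZ; rewrite ltnn.
move=> [B [B_sol _ _] BtB] [i [a [k [k0 nz]]]] _.
have [_ _ nolog] := algebraic_local f_alg Mmin MP PZ.
have [rho _ BtE] := BtB i; move: nz; rewrite BtE (nolog _ (B_sol i)) //.
by rewrite if_same eqxx.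
Qed.

Lemma inspect_all_true M S : inspect_all M S T -> exists s, inspect M s true.
Proof.
by move eo: T => o run; elim: run eo => //= s S' sT _; exists s.
Qed.

Theorem theorem8 (f : series rat) (L : {poly {poly rat}}) (f0 : seq rat)
    (f_sol : solution_from L f0 f)
    (f_unique : forall g : series rat, solution_from L f0 g -> g =1 f) :
  (exists o : answer, TransTest L f0 o) /\
  (forall o : answer, TransTest L f0 o ->
     (o = T \/ o = FAIL) /\ (o = T -> transcendental f)).
Proof.
split; last first.
  move=> o [g M S g_sol Mmin _ _ run]; split; first by case: (o); [left | right].
  move=> eo; rewrite eo in run; have [s sT] := inspect_all_true run.
  have eg : g = f by apply/funext/f_unique.
  by rewrite -eg; apply: inspect_true_transcendental Mmin sT.
have L0 : L != 0.
  apply/eqP => L0; pose g : series rat := fun n => if n == size f0 then f n + 1 else f n.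
  have /f_unique/(_ (size f0))/eqP : solution_from L f0 g.
    split=> [n|]; first by rewrite L0 /op_series size_poly0 big_ord0.
    rewrite -[RHS](f_sol.2); apply/eq_in_map => n; rewrite mem_iota => /andP[_ lt_n].
    by rewrite /g ltn_eqF.
  by rewrite /g eqxx -subr_eq0 addrC addKr oner_eq0.
have [M Mmin] := min_op_exists L0 f_sol.1.
have M0 : M != 0 by case: Mmin => /monic_neq0.
have [S Su SP] := singularities_exist M0.
have [o run] := inspect_all_exists S M0.
by exists o; apply: TransTest_run f_sol Mmin Su SP run.
Qed.
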